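(* Let $K$ be an idempotent semifield and let $X_K$ be a cancellative semiring scheme over $K$. Then $\operatorname{CaCl}(X_K)$ is isomorphic to $\operatorname{Pic}(X_K)$.
   Context: Semirings: a semiring is a commutative semiring (axioms of a commutative ring with $1$ except existence of additive inverses, $0$ being multiplicatively absorbing) with $0\neq1$. A semifield is a semiring in which every nonzero element is multiplicatively invertible; a semiring is idempotent if $a+a=a$ for all $a$. A semiring $A$ is integral if it has no zero divisors, and cancellative if for every nonzero $f\in A$ and all $a,b\in A$, $af=bf$ implies $a=b$. Ideals of $A$ are additive submonoids $I$ with $AI\subseteq I$; a proper ideal $I$ is prime if $ab\in I$ implies $a\in I$ or $b\in I$; $\operatorname{Spec}A$ with its Zariski topology and structure sheaf of semirings (functions $s$ with $s(\mathfrak p)\in A_{\mathfrak p}$, locally given by fractions) are defined as for rings. A semiring scheme is a locally semiringed space (each stalk has a unique maximal ideal) locally isomorphic to such spectra. A semiring scheme $Y$ is cancellative if $Y$ is nonempty and $\mathcal{O}_Y(U)$ is a cancellative semiring for every nonempty open $U\subseteq Y$; ''over $K$'' means that $Y$ is equipped with a morphism to $\operatorname{Spec}K$. Cartier divisors: a cancellative semiring scheme $Y$ is irreducible with a unique generic point $\eta$; its function field is the semifield $F=\mathcal{O}_{Y,\eta}$. Let $\mathcal{K}$ be the constant sheaf on $Y$ associated to $F$, and $\mathcal{K}^\times$ the constant sheaf of abelian groups associated to $F^\times$. The sheaf $\mathcal{O}_Y^\times$ of multiplicatively invertible sections is a subsheaf of abelian groups of $\mathcal{K}^\times$ (via the canonical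 maps to the stalk at $\eta$). A Cartier divisor is a global section of $\mathcal{K}^\times/\mathcal{O}_Y^\times$; these form the group $\operatorname{Cart}(Y)$. A principal Cartier divisor is one represented by a single element of $F^\times=\mathcal{K}^\times(Y)$; these form the subgroup $P(Y)$. $\operatorname{CaCl}(Y)=\operatorname{Cart}(Y)/P(Y)$. Picard group: an invertible sheaf on $Y$ is a sheaf of $\mathcal{O}_Y$-modules locally isomorphic to $\mathcal{O}_Y$; $\operatorname{Pic}(Y)$ is the group of isomorphism classes of invertible sheaves under tensor product over $\mathcal{O}_Y$. It is known that $\operatorname{Pic}(Y)\cong\mathrm{H}^1(Y,\mathcal{O}_Y^\times)$ (sheaf cohomology). *)

(* Defs.v *)
From HB Require Import structures.
From mathcomp Require Import all_boot all_algebra.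
From mathcomp Require Import all_classical.
From mathcomp Require Import topology_structure ring.

Set Implicit Arguments.
Unset Strict Implicit.
Unset Printing Implicit Defensive.

Import GRing.Theory.
Local Open Scope classical_set_scope.
Local Open Scope ring_scope.
Local Open Scope quotient_scope.

(* Sections of a sheaf of semirings only form a [comPzSemiRingType], because
   those over the empty set form the zero semiring.  The condition 0 != 1 is
   imposed on the semirings of which spectra are glued, and over nonempty open
   subsets of a scheme it follows from the stalks being local. *)

Definition is_semifield (A : comPzSemiRingType) : Prop :=
  forall a : A, a <> 0 -> exists b, a * b = 1.

Definition is_idempotent (A : comPzSemiRingType) : Prop :=
  forall a : A, a + a = a.

Definition cancellative (A : comPzSemiRingType) : Prop :=
  forall f : A, f <> 0 -> forall a b, f * a = f * b -> a = b.

Definition is_ideal (A : comPzSemiRingType) (I : set A) : Prop :=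
  [/\ I 0, forall a b, I a -> I b -> I (a + b) & forall a b, I b -> I (a * b)].

Definition is_prime (A : comPzSemiRingType) (I : set A) : Prop :=
  [/\ is_ideal I, I <> setT & forall a b, I (a * b) -> I a \/ I b].

Definition is_maximal (A : comPzSemiRingType) (I : set A) : Prop :=
  [/\ is_ideal I, I <> setT &
      forall J : set A, is_ideal J -> J <> setT -> I `<=` J -> J = I].

Definition is_local (A : comPzSemiRingType) : Prop :=
  exists! m : set A, is_maximal m.

Lemma ideal_neqT (A : comPzSemiRingType) (I : set A) :
  is_ideal I -> I <> setT -> ~ I 1.
Proof.
move=> [_ _ IM] nT I1; apply: nT; apply/seteqP; split=> // a _.
by rewrite -[a]mulr1; apply: IM.
Qed.

(* The group of invertible elements; its law, multiplication in A, is written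
   additively so that the library's quotients of Z-modules apply. *)
Record units (A : comPzSemiRingType) := Units {
  uval : A; uinv : A; uvalK : uval * uinv = 1 }.

Section Units.
Variable A : comPzSemiRingType.
Implicit Types u v w : units A.

Lemma units_inj u v : uval u = uval v -> u = v.
Proof.
case: u v => [a b ab] [a' b' ab'] /= e; subst a'.
have e : b = b' by rewrite -[b]mul1r -ab' mulrAC ab mul1r.
by subst b'; congr Units; apply: Prop_irrelevance.
Qed.

HB.instance Definition _ := gen_eqMixin (units A).
HB.instance Definition _ := gen_choiceMixin (units A).

Fact units_mulK u v : (uval u * uval v) * (uinv u * uinv v) = 1.
Proof. by rewrite mulrACA !uvalK mulr1. Qed.
Definition units_mul u v := Units (units_mulK u v).
Definition units_one := Units (mulr1 (1 : A)).
Fact units_invK u : uinv u * uval u = 1.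
Proof. by rewrite mulrC uvalK. Qed.
Definition units_inv u := Units (units_invK u).

Fact units_mulA : associative units_mul.
Proof. by move=> u v w; apply: units_inj; rewrite /= mulrA. Qed.
Fact units_mulC : commutative units_mul.
Proof. by move=> u v; apply: units_inj; rewrite /= mulrC. Qed.
Fact units_mul1 : left_id units_one units_mul.
Proof. by move=> u; apply: units_inj; rewrite /= mul1r. Qed.
Fact units_mulV : left_inverse units_one units_inv units_mul.
Proof. by move=> u; apply: units_inj; rewrite /= mulrC uvalK. Qed.

HB.instance Definition _ := GRing.isZmodule.Build (units A)
  units_mulA units_mulC units_mul1 units_mulV.
End Units.

Identity Coercion fun_of_set : set >-> Funclass.

Record opens (X : topologicalType) := Opens {
  oset :> set X; openO : open oset }.

Definition opensT (X : topologicalType) : opens X := Opens (@openT X).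

Lemma subopensT (X : topologicalType) (U : opens X) : U `<=` opensT X.
Proof. by []. Qed.

Definition opensI (X : topologicalType) (U V : opens X) : opens X :=
  Opens (openI (openO U) (openO V)).

Lemma opensIl (X : topologicalType) (U V : opens X) : opensI U V `<=` U.
Proof. by move=> x []. Qed.

Lemma opensIr (X : topologicalType) (U V : opens X) : opensI U V `<=` V.
Proof. by move=> x []. Qed.

Definition opens_preim (X Y : topologicalType) (f : X -> Y) (cf : continuous f)
    (V : opens Y) : opens X :=
  Opens ((continuousP f).1 cf V (openO V)).

(* Sections of a family agree on the intersection of two members of a cover iff
   they agree on every open subset W of it. *)
Definition is_sheaf (X : topologicalType) (F : opens X -> Type)
    (r : forall U V : opens X, V `<=` U -> F U -> F V) : Prop :=
  [/\ (forall (U : opens X) (h : U `<=` U) (s : F U), r U U h s = s),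
      (forall (U V W : opens X) (hV : V `<=` U) (hW : W `<=` V) (hWU : W `<=` U) (s : F U),
         r V W hW (r U V hV s) = r U W hWU s),
      (forall (U : opens X) (I : Type) (V : I -> opens X)
         (hV : forall i, V i `<=` U), U `<=` \bigcup_i V i ->
         forall s t : F U, (forall i, r U (V i) (hV i) s = r U (V i) (hV i) t) ->
         s = t)
    & (forall (U : opens X) (I : Type) (V : I -> opens X)
         (hV : forall i, V i `<=` U), U `<=` \bigcup_i V i ->
         forall s : forall i, F (V i),
         (forall i j (W : opens X) (hi : W `<=` V i) (hj : W `<=` V j),
            r (V i) W hi (s i) = r (V j) W hj (s j)) ->
         exists t : F U, forall i, r U (V i) (hV i) t = s i)].

Record srsheaf (X : topologicalType) := SRSheaf {
  sec :> opens X -> comPzSemiRingType;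
  res : forall U V : opens X, V `<=` U -> {rmorphism sec U -> sec V};
  sheafP : is_sheaf (fun U V h => res h : sec U -> sec V) }.
Arguments res {X} s {U V} _.

Section Stalk.
Variables (X : topologicalType) (F : srsheaf X) (x : X).

Record pregerm := Pregerm {
  pg_open : opens X; pg_mem : pg_open x; pg_sec : F pg_open }.

HB.instance Definition _ := gen_eqMixin pregerm.
HB.instance Definition _ := gen_choiceMixin pregerm.

Definition germ_equivP (g h : pregerm) : Prop :=
  exists (W : opens X) (hg : W `<=` pg_open g) (hh : W `<=` pg_open h),
    W x /\ res F hg (pg_sec g) = res F hh (pg_sec h).

Definition germ_equiv (g h : pregerm) : bool := `[< germ_equivP g h >].

Lemma resres (U V W : opens X) (hV : V `<=` U) (hW : W `<=` V)
  (hWU : W `<=` U) s : res F hW (res F hV s) = res F hWU s.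
Proof. by case: (sheafP F) => _ h _ _; apply: h. Qed.

Lemma resE (U V W : opens X) (hV : V `<=` U) (hW : W `<=` V) s :
  res F hW (res F hV s) = res F (subset_trans hW hV) s.
Proof. exact: resres. Qed.

Lemma res_irr (U V : opens X) (h k : V `<=` U) s : res F h s = res F k s.
Proof. by congr (res F _ _); apply: Prop_irrelevance. Qed.

Fact germ_equiv_class : equiv_class_of germ_equiv.
Proof.
split=> [g|g h|h g k].
- by apply/asboolP; exists (pg_open g), (fun=> id), (fun=> id); split=> //; case: g.
- by apply/asboolP/asboolP => -[W [hg [hh [Wx e]]]]; exists W, hh, hg.
- move=> /asboolP[W [hg [hh [Wx e]]]] /asboolP[W' [hg' [hh' [Wx' e']]]].
  apply/asboolP; exists (opensI W W'), (subset_trans (@opensIl _ W W') hg),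
    (subset_trans (@opensIr _ W W') hh'); split=> //.
  transitivity (res F (@opensIl _ W W') (res F hg (pg_sec g))).
    by rewrite resE; apply: res_irr.
  transitivity (res F (@opensIr _ W W') (res F hh' (pg_sec k))).
    by rewrite e -e' !resE; apply: res_irr.
  by rewrite resE; apply: res_irr.
Qed.

Canonical germ_eqv := EquivRelPack germ_equiv_class.
Canonical germ_encModRel := defaultEncModRel germ_equiv.
Definition stalk : Type := {eq_quot germ_equiv}.
HB.instance Definition _ : EqQuotient pregerm germ_equiv stalk :=
  EqQuotient.on stalk.
HB.instance Definition _ := Choice.on stalk.

Definition germ (U : opens X) (hU : U x) (s : F U) : stalk :=
  \pi_stalk (Pregerm hU s).

Lemma germP (U V : opens X) (hU : U x) (hV : V x) (s : F U) (t : F V) :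
  germ hU s = germ hV t <->
  exists (W : opens X) (h : W `<=` U) (k : W `<=` V),
    W x /\ res F h s = res F k t.
Proof.
split=> [/eqP|h]; first by rewrite eqmodE => /asboolP.
by apply/eqP; rewrite eqmodE; apply/asboolP.
Qed.

Lemma germ_res (U V : opens X) (hU : U x) (hV : V x) (h : V `<=` U) (s : F U) :
  germ hV (res F h s) = germ hU s.
Proof. by apply/germP; exists V, (fun=> id), h; split=> //; rewrite resE; apply: res_irr. Qed.

Lemma stalkW (a : stalk) : exists (U : opens X) (hU : U x) (s : F U),
  a = germ hU s.
Proof.
by elim/quotW: a => -[U hU s]; exists U, hU, s.
Qed.

Lemma germ_common (U V : opens X) (hU : U x) (hV : V x) (s : F U) (t : F V) :
  exists (W : opens X) (hW : W x) (s' t' : F W),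
    germ hU s = germ hW s' /\ germ hV t = germ hW t'.
Proof.
have hW : opensI U V x by split.
exists (opensI U V), hW, (res F (@opensIl _ U V) s),
  (res F (@opensIr _ U V) t).
by split; rewrite germ_res.
Qed.

Lemma stalkW2 (a b : stalk) : exists (U : opens X) (hU : U x) (s t : F U),
  a = germ hU s /\ b = germ hU t.
Proof.
have [U [hU [s ->]]] := stalkW a; have [V [hV [t ->]]] := stalkW b.
exact: germ_common.
Qed.

Lemma stalkW3 (a b c : stalk) : exists (U : opens X) (hU : U x) (s t r : F U),
  [/\ a = germ hU s, b = germ hU t & c = germ hU r].
Proof.
have [U [hU [s [t [-> ->]]]]] := stalkW2 a b; have [V [hV [r ->]]] := stalkW c.
have [W [hW [s' [r' [es er]]]]] := germ_common hU hV s r.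
have [W' [hW' [t' [r'' [et er']]]]] := germ_common hU hW t r'.
have [W2 [hW2 [s2 [t2 [es2 et2]]]]] := germ_common hW hW' s' t'.
have h : opensI W2 W x by split.
exists (opensI W2 W), h, (res F (@opensIl _ W2 W) s2),
  (res F (@opensIl _ W2 W) t2), (res F (@opensIr _ W2 W) r').
by split; rewrite germ_res ?es ?et.
Qed.

Definition germ_op (op : forall U, F U -> F U -> F U) (a b : stalk) : stalk :=
  let g := repr a in let h := repr b in
  germ (U := opensI (pg_open g) (pg_open h)) (conj (pg_mem g) (pg_mem h))
    (op _ (res F (@opensIl _ (pg_open g) (pg_open h)) (pg_sec g))
          (res F (@opensIr _ (pg_open g) (pg_open h)) (pg_sec h))).

Lemma germ_opE (op : forall U, F U -> F U -> F U) :
  (forall (U V : opens X) (h : V `<=` U) s t,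
     res F h (op U s t) = op V (res F h s) (res F h t)) ->
  forall (U : opens X) (hU : U x) (s t : F U),
  germ_op op (germ hU s) (germ hU t) = germ hU (op U s t).
Proof.
move=> opr U hU s t; rewrite /germ_op.
have /esym/eqP := reprK (germ hU s); have /esym/eqP := reprK (germ hU t).
rewrite !eqmodE; case: (repr _) => [V hV v]; case: (repr _) => [W hW w] /=.
move=> /asboolP/= [P [p1 [p2 [Px ep]]]] /asboolP/= [Q [q1 [q2 [Qx eq]]]].
apply/germP.
have PQV : opensI P Q `<=` opensI W V.
  by move=> z [Pz Qz]; split; [exact: (q2 _ Qz)|exact: (p2 _ Pz)].
have PQU : opensI P Q `<=` U by move=> z [Pz _]; exact: (p1 _ Pz).
exists (opensI P Q), PQV, PQU; split; first by split.
rewrite !opr; congr op.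
  transitivity (res F (@opensIr _ P Q) (res F q1 s)).
    by rewrite eq !resE; apply: res_irr.
  by rewrite resE; apply: res_irr.
transitivity (res F (@opensIl _ P Q) (res F p1 t)).
  by rewrite ep !resE; apply: res_irr.
by rewrite resE; apply: res_irr.
Qed.

Definition stalk_add := germ_op (fun U => +%R).
Definition stalk_mul := germ_op (fun U => *%R).
Definition stalk_zero := germ (U := opensT X) I 0.
Definition stalk_one := germ (U := opensT X) I 1.

Lemma stalk_addE (U : opens X) (hU : U x) (s t : F U) :
  stalk_add (germ hU s) (germ hU t) = germ hU (s + t).
Proof. by apply: germ_opE => *; rewrite rmorphD. Qed.
Lemma stalk_mulE (U : opens X) (hU : U x) (s t : F U) :
  stalk_mul (germ hU s) (germ hU t) = germ hU (s * t).
Proof. by apply: germ_opE => *; rewrite rmorphM. Qed.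
Lemma stalk_zeroE (U : opens X) (hU : U x) : stalk_zero = germ hU 0.
Proof.
by rewrite -(rmorph0 (res F (@subopensT _ U))) (germ_res (U := opensT X) I).
Qed.
Lemma stalk_oneE (U : opens X) (hU : U x) : stalk_one = germ hU 1.
Proof.
by rewrite -(rmorph1 (res F (@subopensT _ U))) (germ_res (U := opensT X) I).
Qed.

Fact stalk_addA : associative stalk_add.
Proof.
move=> a b c; have [U [hU [s [t [r [-> -> ->]]]]]] := stalkW3 a b c.
by rewrite !stalk_addE addrA.
Qed.
Fact stalk_addC : commutative stalk_add.
Proof.
move=> a b; have [U [hU [s [t [-> ->]]]]] := stalkW2 a b.
by rewrite !stalk_addE addrC.
Qed.
Fact stalk_add0 : left_id stalk_zero stalk_add.
Proof.
move=> a; have [U [hU [s ->]]] := stalkW a.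
by rewrite (stalk_zeroE hU) stalk_addE add0r.
Qed.
Fact stalk_mulA : associative stalk_mul.
Proof.
move=> a b c; have [U [hU [s [t [r [-> -> ->]]]]]] := stalkW3 a b c.
by rewrite !stalk_mulE mulrA.
Qed.
Fact stalk_mulC : commutative stalk_mul.
Proof.
move=> a b; have [U [hU [s [t [-> ->]]]]] := stalkW2 a b.
by rewrite !stalk_mulE mulrC.
Qed.
Fact stalk_mul1 : left_id stalk_one stalk_mul.
Proof.
move=> a; have [U [hU [s ->]]] := stalkW a.
by rewrite (stalk_oneE hU) stalk_mulE mul1r.
Qed.
Fact stalk_mulD : left_distributive stalk_mul stalk_add.
Proof.
move=> a b c; have [U [hU [s [t [r [-> -> ->]]]]]] := stalkW3 a b c.
by rewrite !(stalk_mulE, stalk_addE) mulrDl.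
Qed.
Fact stalk_mul0 : left_zero stalk_zero stalk_mul.
Proof.
move=> a; have [U [hU [s ->]]] := stalkW a.
by rewrite (stalk_zeroE hU) stalk_mulE mul0r.
Qed.

HB.instance Definition _ := GRing.isNmodule.Build stalk
  stalk_addA stalk_addC stalk_add0.
HB.instance Definition _ := GRing.Nmodule_isComPzSemiRing.Build stalk
  stalk_mulA stalk_mulC stalk_mul1 stalk_mulD stalk_mul0.

Lemma germD (U : opens X) (hU : U x) (s t : F U) :
  germ hU (s + t) = germ hU s + germ hU t.
Proof. by rewrite -stalk_addE. Qed.
Lemma germM (U : opens X) (hU : U x) (s t : F U) :
  germ hU (s * t) = germ hU s * germ hU t.
Proof. by rewrite -stalk_mulE. Qed.
Lemma germ0 (U : opens X) (hU : U x) : germ hU 0 = 0.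
Proof. by rewrite -stalk_zeroE. Qed.
Lemma germ1 (U : opens X) (hU : U x) : germ hU 1 = 1.
Proof. by rewrite -stalk_oneE. Qed.

End Stalk.
Arguments germ {X} F {x U} hU s.

Record srspace := SRSpace {
  space :> topologicalType; sheafO : srsheaf space }.
Record spec (A : comPzSemiRingType) := SpecPoint {
  pset :> set A; psetP : is_prime pset }.

Section SpecTopology.
Variable A : comPzSemiRingType.
Implicit Types p : spec A.

Lemma spec_inj p q : pset p = pset q -> p = q.
Proof.
case: p q => [p hp] [q hq] /= e; subst q; congr SpecPoint.
exact: Prop_irrelevance.
Qed.

Lemma spec1 p : ~ p 1.
Proof. by case: (psetP p) => i n _; apply: ideal_neqT. Qed.

Lemma specMl p a b : p b -> p (a * b).
Proof. by case: (psetP p) => -[_ _ h] _ _; apply: h. Qed.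

Lemma specM p a b : ~ p a -> ~ p b -> ~ p (a * b).
Proof. by case: (psetP p) => _ _ h na nb /h[]. Qed.

HB.instance Definition _ := gen_eqMixin (spec A).
HB.instance Definition _ := gen_choiceMixin (spec A).

(* The open subsets are the complements of the sets V(E) of primes containing
   a given subset E of A. *)
Definition spec_open : set_system (spec A) :=
  [set U | exists E : set A, U = [set p : spec A | ~ E `<=` p]].

Fact spec_openT : spec_open setT.
Proof.
exists [set 1]; apply/seteqP; split=> // p _ /(_ 1 erefl).
exact: spec1.
Qed.

Fact spec_openI : setI_closed spec_open.
Proof.
move=> _ _ [E ->] [E' ->].
exists [set c | exists a b, [/\ E a, E' b & c = a * b]].
apply/seteqP; split=> p /=.
- move=> [/existsNP[a /not_implyP[Ea pa]] /existsNP[b /not_implyP[Eb pb]]] h.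
  by apply: (specM pa pb); apply: h; exists a, b.
- move=> h; split=> h'; apply: h => _ [a [b [Ea Eb ->]]].
    by rewrite mulrC; apply: specMl; apply: h'.
  by apply: specMl; apply: h'.
Qed.

Fact spec_openU (I : Type) (f : I -> set (spec A)) :
  (forall i, spec_open (f i)) -> spec_open (\bigcup_i f i).
Proof.
move=> h; exists (\bigcup_i (get [set E | f i = [set p : spec A | ~ E `<=` p]])).
have hi i := getPex (h i).
apply/seteqP; split=> p /=.
- by move=> [i _]; rewrite (hi i) /= => n h'; apply: n => a Ea; apply: h'; exists i.
- move=> /existsNP[a /not_implyP[[i _ Ea] pa]]; exists i => //.
  by rewrite (hi i) /= => /(_ a Ea).
Qed.

HB.instance Definition _ := isOpenTopological.Build (spec A)
  spec_openT spec_openI spec_openU.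
End SpecTopology.

Section Localization.
Variables (A : comPzSemiRingType) (p : spec A).

Record fraction := Fraction { num : A; den : A; denP : ~ p den }.
Arguments denP f _ : rename, clear implicits.

HB.instance Definition _ := gen_eqMixin fraction.
HB.instance Definition _ := gen_choiceMixin fraction.

Definition frac_equiv (x y : fraction) : bool :=
  `[< exists u, ~ p u /\ u * (num x * den y) = u * (num y * den x) >].

Fact frac_equiv_class : equiv_class_of frac_equiv.
Proof.
split=> [x|x y|y x z].
- by apply/asboolP; exists 1; split=> //; apply: spec1.
- by apply/asboolP/asboolP => -[u [pu e]]; exists u.
- move=> /asboolP[u [pu e]] /asboolP[v [pv e']]; apply/asboolP.
  exists (u * v * den y); split.
    by apply: specM; [apply: specM|apply: denP].
  transitivity (v * den z * (u * (num x * den y))); first by ring.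
  transitivity (u * den x * (v * (num y * den z))); first by rewrite e; ring.
  by rewrite e'; ring.
Qed.

Canonical frac_eqv := EquivRelPack frac_equiv_class.
Canonical frac_encModRel := defaultEncModRel frac_equiv.
Definition localization : Type := {eq_quot frac_equiv}.
HB.instance Definition _ : EqQuotient fraction frac_equiv localization :=
  EqQuotient.on localization.
HB.instance Definition _ := Choice.on localization.

Definition frac (x : fraction) : localization := \pi_localization x.

Lemma fracP (x y : fraction) :
  frac x = frac y <->
  exists u, ~ p u /\ u * (num x * den y) = u * (num y * den x).
Proof.
split=> [/eqP|h]; first by rewrite eqmodE => /asboolP.
by apply/eqP; rewrite eqmodE; apply/asboolP.
Qed.

Lemma fracW (P : localization -> Prop) :
  (forall x, P (frac x)) -> forall a, P a.
Proof. exact: quotW. Qed.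

Definition fadd (x y : fraction) : fraction :=
  Fraction (num x * den y + num y * den x) (specM (denP x) (denP y)).
Definition fmul (x y : fraction) : fraction :=
  Fraction (num x * num y) (specM (denP x) (denP y)).
Definition fzero : fraction := Fraction 0 (@spec1 A p).
Definition fone : fraction := Fraction 1 (@spec1 A p).

Definition loc_add (a b : localization) : localization :=
  frac (fadd (repr a) (repr b)).
Definition loc_mul (a b : localization) : localization :=
  frac (fmul (repr a) (repr b)).

Lemma frac_repr x : exists u, ~ p u /\
  u * (num (repr (frac x)) * den x) = u * (num x * den (repr (frac x))).
Proof. by apply/fracP; rewrite [LHS]reprK. Qed.

Lemma loc_addE x y : loc_add (frac x) (frac y) = frac (fadd x y).
Proof.
have [u [pu e]] := frac_repr x; have [v [pv e']] := frac_repr y.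
apply/fracP; exists (u * v); split; first exact: specM.
rewrite /=; set a := repr _ in e *; set b := repr _ in e' *.
transitivity (v * den y * den b * (u * (num a * den x)) +
              u * den x * den a * (v * (num b * den y))); first by ring.
by rewrite e e'; ring.
Qed.

Lemma loc_mulE x y : loc_mul (frac x) (frac y) = frac (fmul x y).
Proof.
have [u [pu e]] := frac_repr x; have [v [pv e']] := frac_repr y.
apply/fracP; exists (u * v); split; first exact: specM.
rewrite /=; set a := repr _ in e *; set b := repr _ in e' *.
transitivity ((u * (num a * den x)) * (v * (num b * den y))); first by ring.
by rewrite e e'; ring.
Qed.

Lemma frac_eq x y : num x * den y = num y * den x -> frac x = frac y.
Proof. by move=> e; apply/fracP; exists 1; rewrite e; split=> //; apply: spec1. Qed.

Fact loc_addA : associative loc_add.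
Proof.
elim/fracW=> x; elim/fracW=> y; elim/fracW=> z; rewrite !loc_addE.
by apply: frac_eq => /=; ring.
Qed.
Fact loc_addC : commutative loc_add.
Proof.
elim/fracW=> x; elim/fracW=> y; rewrite !loc_addE.
by apply: frac_eq => /=; ring.
Qed.
Fact loc_add0 : left_id (frac fzero) loc_add.
Proof. by elim/fracW=> x; rewrite loc_addE; apply: frac_eq => /=; ring. Qed.
Fact loc_mulA : associative loc_mul.
Proof.
elim/fracW=> x; elim/fracW=> y; elim/fracW=> z; rewrite !loc_mulE.
by apply: frac_eq => /=; ring.
Qed.
Fact loc_mulC : commutative loc_mul.
Proof.
elim/fracW=> x; elim/fracW=> y; rewrite !loc_mulE.
by apply: frac_eq => /=; ring.
Qed.
Fact loc_mul1 : left_id (frac fone) loc_mul.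
Proof. by elim/fracW=> x; rewrite loc_mulE; apply: frac_eq => /=; ring. Qed.
Fact loc_mulD : left_distributive loc_mul loc_add.
Proof.
elim/fracW=> x; elim/fracW=> y; elim/fracW=> z.
by rewrite !(loc_mulE, loc_addE); apply: frac_eq => /=; ring.
Qed.
Fact loc_mul0 : left_zero (frac fzero) loc_mul.
Proof. by elim/fracW=> x; rewrite loc_mulE; apply: frac_eq => /=; ring. Qed.

HB.instance Definition _ := GRing.isNmodule.Build localization
  loc_addA loc_addC loc_add0.
HB.instance Definition _ := GRing.Nmodule_isComPzSemiRing.Build localization
  loc_mulA loc_mulC loc_mul1 loc_mulD loc_mul0.
End Localization.
Arguments Fraction {A} p num {den} denP.

Section SpecSheaf.
Variable A : comPzSemiRingType.
Implicit Types U V : opens (spec A).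

Definition locally_fraction U (s : forall p : spec A, U p -> localization p) :=
  forall p, U p -> exists (V : opens (spec A)) (hVU : V `<=` U) (a f : A),
    V p /\ forall q (hq : V q), exists hf : ~ q f,
      s q (hVU q hq) = frac (Fraction q a hf).

Record spec_sec U := SpecSec {
  sfun : forall p : spec A, U p -> localization p;
  sfunP : locally_fraction sfun }.

Lemma spec_sec_inj U (s t : spec_sec U) :
  (forall p (hp : U p), sfun s hp = sfun t hp) -> s = t.
Proof.
case: s t => [s hs] [t ht] /= e.
have {}e : s = t.
  by apply: functional_extensionality_dep => p; apply: functional_extensionality_dep.
by subst t; congr SpecSec; apply: Prop_irrelevance.
Qed.

HB.instance Definition _ U := gen_eqMixin (spec_sec U).
HB.instance Definition _ U := gen_choiceMixin (spec_sec U).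

Lemma locally_fraction_cst U a (f : A) (hf : forall p : spec A, ~ p f) :
  locally_fraction (fun p (_ : U p) => frac (Fraction p a (hf p))).
Proof.
by move=> p hp; exists U, (fun=> id), a, f; split=> // q _; exists (hf q).
Qed.

Definition spec_zero U := SpecSec (@locally_fraction_cst U 0 1 (@spec1 A)).
Definition spec_one U := SpecSec (@locally_fraction_cst U 1 1 (@spec1 A)).

Lemma locally_fraction_op U (s t : spec_sec U)
  (op : forall p : spec A, localization p -> localization p -> localization p)
  (fop : forall p : spec A, fraction p -> fraction p -> fraction p)
  (n : A -> A -> A -> A -> A) :
  (forall p (x y : fraction p), op p (frac x) (frac y) = frac (fop p x y)) ->
  (forall p (x y : fraction p), num (fop p x y) = n (num x) (den x) (num y) (den y)) ->
  (forall p (x y : fraction p), den (fop p x y) = den x * den y) ->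
  locally_fraction (fun p (hp : U p) => op p (sfun s hp) (sfun t hp)).
Proof.
move=> opE nE dE p hp.
have [V [hV [a [f [Vp e]]]]] := sfunP s hp.
have [W [hW [b [g [Wp e']]]]] := sfunP t hp.
exists (opensI V W), (subset_trans (@opensIl _ V W) hV), (n a f b g), (f * g).
split=> // q [Vq Wq].
have [qf ef] := e q Vq; have [qg eg] := e' q Wq.
exists (specM qf qg).
rewrite (Prop_irrelevance (subset_trans _ _ _) (hV q Vq)) ef.
rewrite (Prop_irrelevance (hV q Vq) (hW q Wq)) eg opE.
by apply: frac_eq => /=; rewrite nE dE.
Qed.

Fact locally_fraction_add U (s t : spec_sec U) :
  locally_fraction (fun p (hp : U p) => sfun s hp + sfun t hp).
Proof.
by apply: (@locally_fraction_op _ _ _ (fun p => +%R) (@fadd A)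
  (fun a f b g => a * g + b * f)) => // *; apply: loc_addE.
Qed.
Fact locally_fraction_mul U (s t : spec_sec U) :
  locally_fraction (fun p (hp : U p) => sfun s hp * sfun t hp).
Proof.
by apply: (@locally_fraction_op _ _ _ (fun p => *%R) (@fmul A)
  (fun a f b g => a * b)) => // *; apply: loc_mulE.
Qed.

Definition spec_add U s t := SpecSec (@locally_fraction_add U s t).
Definition spec_mul U s t := SpecSec (@locally_fraction_mul U s t).

Section SectionSemiRing.
Variable U : opens (spec A).
Fact spec_addA : associative (@spec_add U).
Proof. by move=> a b c; apply: spec_sec_inj => p hp /=; rewrite addrA. Qed.
Fact spec_addC : commutative (@spec_add U).
Proof. by move=> a b; apply: spec_sec_inj => p hp /=; rewrite addrC. Qed.
Fact spec_add0 : left_id (@spec_zero U) (@spec_add U).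
Proof. by move=> a; apply: spec_sec_inj => p hp /=; exact: add0r. Qed.
Fact spec_mulA : associative (@spec_mul U).
Proof. by move=> a b c; apply: spec_sec_inj => p hp /=; rewrite mulrA. Qed.
Fact spec_mulC : commutative (@spec_mul U).
Proof. by move=> a b; apply: spec_sec_inj => p hp /=; rewrite mulrC. Qed.
Fact spec_mul1 : left_id (@spec_one U) (@spec_mul U).
Proof. by move=> a; apply: spec_sec_inj => p hp /=; exact: mul1r. Qed.
Fact spec_mulD : left_distributive (@spec_mul U) (@spec_add U).
Proof. by move=> a b c; apply: spec_sec_inj => p hp /=; rewrite mulrDl. Qed.
Fact spec_mul0 : left_zero (@spec_zero U) (@spec_mul U).
Proof. by move=> a; apply: spec_sec_inj => p hp /=; exact: mul0r. Qed.

HB.instance Definition _ := GRing.isNmodule.Build (spec_sec U)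
  spec_addA spec_addC spec_add0.
HB.instance Definition _ := GRing.Nmodule_isComPzSemiRing.Build (spec_sec U)
  spec_mulA spec_mulC spec_mul1 spec_mulD spec_mul0.
End SectionSemiRing.

Section Restriction.
Variables (U V : opens (spec A)) (h : V `<=` U).

Fact spec_res_subproof (s : spec_sec U) :
  locally_fraction (fun p (hp : V p) => sfun s (h hp)).
Proof.
move=> p hp; have [W [hW [a [f [Wp e]]]]] := sfunP s (h hp).
exists (opensI V W), (@opensIl _ V W), a, f; split=> // q [Vq Wq].
have [hf ef] := e q Wq; exists hf; rewrite -ef.
by congr (sfun _ _); apply: Prop_irrelevance.
Qed.

Definition spec_res s : spec_sec V := SpecSec (spec_res_subproof s).

Fact spec_res_nmod : nmod_morphism spec_res.
Proof. by split=> [|s t]; apply: spec_sec_inj. Qed.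
Fact spec_res_monoid : monoid_morphism spec_res.
Proof. by split=> [|s t]; apply: spec_sec_inj. Qed.

HB.instance Definition _ := GRing.isNmodMorphism.Build _ _ spec_res spec_res_nmod.
HB.instance Definition _ := GRing.isMonoidMorphism.Build _ _ spec_res spec_res_monoid.

Definition spec_resM : {rmorphism spec_sec U -> spec_sec V} := spec_res.
End Restriction.

Fact spec_sheafP :
  is_sheaf (fun U V (h : V `<=` U) => spec_resM h : spec_sec U -> spec_sec V).
Proof.
split=> [U h s|U V W hV hW hWU s|U I V hV cov s t e|U I V hV cov s e].
- by apply: spec_sec_inj => p hp /=; congr (sfun _ _); apply: Prop_irrelevance.
- by apply: spec_sec_inj => p hp /=; congr (sfun _ _); apply: Prop_irrelevance.
- apply: spec_sec_inj => p hp; have [i _ Vp] := cov p hp.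
  have /(congr1 (fun s => sfun s Vp)) /= := e i.
  by rewrite (Prop_irrelevance (hV i p Vp) hp).
- have ee i j p (hi : V i p) (hj : V j p) : sfun (s i) hi = sfun (s j) hj.
    have h : opensI (V i) (V j) p by split.
    have /(congr1 (fun s => sfun s h)) /= := e i j _ (@opensIl _ _ _) (@opensIr _ _ _).
    by rewrite (Prop_irrelevance (opensIl h) hi) (Prop_irrelevance (opensIr h) hj).
  have cov' p (hp : U p) : exists i, V i p by have [i _ h] := cov p hp; exists i.
  pose idx p hp := projT1 (cid (cov' p hp)).
  have idxP p hp : V (idx p hp) p := projT2 (cid (cov' p hp)).
  pose t p (hp : U p) : localization p := sfun (s (idx p hp)) (idxP p hp).
  have tE i p (hp : U p) (hi : V i p) : t p hp = sfun (s i) hi by exact: ee.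
  have tP : locally_fraction t.
    move=> p hp; have [i Vp] := cov' p hp.
    have [W [hW [a [f [Wp eW]]]]] := sfunP (s i) Vp.
    exists W, (subset_trans hW (hV i)), a, f; split=> // q Wq.
    by have [hf e0] := eW q Wq; exists hf; rewrite -e0; apply: tE.
  by exists (SpecSec tP) => i; apply: spec_sec_inj => p hp /=; apply: tE.
Qed.

Definition spec_sheaf : srsheaf (spec A) := SRSheaf spec_sheafP.
Definition Spec : srspace := SRSpace spec_sheaf.
End SpecSheaf.
Record srmorph (X Y : srspace) := SRMorph {
  mor :> X -> Y;
  mor_cont : continuous mor;
  pull : forall V : opens Y,
    {rmorphism sheafO Y V -> sheafO X (opens_preim mor_cont V)};
  pull_res : forall (U V : opens Y) (h : V `<=` U)
    (h' : opens_preim mor_cont V `<=` opens_preim mor_cont U) s,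
    pull V (res (sheafO Y) h s) = res (sheafO X) h' (pull U s) }.

Arguments mor_cont {X Y} s x : rename.

(* The maps induced on stalks pull the maximal ideal back to the maximal
   ideal. *)
Definition is_local_mor (X Y : srspace) (f : srmorph X Y) : Prop :=
  forall (x : X) (m : set (stalk (sheafO Y) (f x))) (n : set (stalk (sheafO X) x)),
  is_maximal m -> is_maximal n ->
  forall (V : opens Y) (hV : V (f x)) (s : sheafO Y V),
    m (germ (sheafO Y) hV s) <->
    n (germ (sheafO X) (U := opens_preim (mor_cont f) V) hV (pull f V s)).

(* An isomorphism of X with the open subspace range f of Y: the sections of the
   restricted sheaf are those over the open subsets V of range f. *)
Definition is_open_immersion (X Y : srspace) (f : srmorph X Y) : Prop :=
  [/\ injective f, forall U : set X, open U -> open (f @` U)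
    & forall V : opens Y, V `<=` range f -> bijective (pull f V)].

Definition is_scheme (Y : srspace) : Prop :=
  (forall y : Y, is_local (stalk (sheafO Y) y)) /\
  (forall y : Y, exists (A : comNzSemiRingType) (j : srmorph (Spec A) Y),
     is_open_immersion j /\ range j y).

Record scheme := Scheme {
  scheme_space :> srspace; schemeP : is_scheme scheme_space }.

Definition is_cancellative (Y : scheme) : Prop :=
  [set: Y] !=set0 /\
  forall U : opens Y, U !=set0 -> cancellative (sheafO Y U).

Definition is_generic (X : topologicalType) (x : X) : Prop :=
  closure [set x] = setT.

Section GenericPoint.
Variables (Y : scheme) (hY : is_cancellative Y).

Lemma sections_nontrivial (U : opens Y) :
  U !=set0 -> (1 : sheafO Y U) <> 0.
Proof.
move=> [x Ux] e; have [locY _] := schemeP Y.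
have [m [[idm mT _] _]] := locY x; have := ideal_neqT idm mT; apply.
by rewrite -(germ1 _ Ux) e germ0; case: idm.
Qed.

Lemma scheme_irreducible (U V : opens Y) : U !=set0 -> V !=set0 ->
  opensI U V !=set0.
Proof.
move=> U0 V0; apply: contrapT => UV0.
pose W := Opens (openU (openO U) (openO V)).
have hU : U `<=` W by left.
have hV : V `<=` W by right.
pose B (b : bool) := if b then U else V.
have hB b : B b `<=` W by case: b.
have cov : W `<=` \bigcup_b B b by move=> x [|] h; [exists true|exists false].
have [_ _ _ /(_ W bool B hB cov) glue] := sheafP (sheafO Y).
have disj (P : opens Y) : P `<=` U -> P `<=` V ->
    forall s t : sheafO Y P, s = t.
  move=> PU PV s t; have [_ _ /(_ P void) sep _] := sheafP (sheafO Y).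
  pose N (i : void) : opens Y := match i with end.
  have hN i : N i `<=` P by case: i.
  apply: (sep N hN) => [x Px|[]//].
  by exfalso; apply: UV0; exists x; split; [apply: PU|apply: PV].
have mk (f : forall b, sheafO Y (B b)) :
    exists s : sheafO Y W, forall b, res (sheafO Y) (hB b) s = f b.
  apply: glue => b b' P; case: b b' => -[] hi hj; do ?exact: res_irr.
    exact: disj hi hj _ _.
  exact: disj hj hi _ _.
have [s es] := mk (fun b => if b then 1 else 0).
have [t et] := mk (fun b => if b then 0 else 1).
have W0 : W !=set0 by case: U0 => x Ux; exists x; left.
have s0 : s <> 0.
  move=> e; apply: (sections_nontrivial U0).
  by have := es true; rewrite e rmorph0.
have st : s * t = s * 0.
  rewrite mulr0; have [_ _ /(_ W bool B hB cov) sep _] := sheafP (sheafO Y).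
  apply: sep => b; rewrite rmorphM rmorph0 es et.
  by case: b; rewrite ?mulr0 ?mul0r.
have t0 := hY.2 W W0 s s0 t 0 st.
apply: (sections_nontrivial V0).
by have := et false; rewrite t0 rmorph0.
Qed.

Lemma spec_generic (A : comPzSemiRingType) (U : opens (spec A)) :
  (forall p, U p) -> (1 : spec_sec U) <> 0 -> cancellative (spec_sec U) ->
  exists p : spec A, forall V : set (spec A), open V -> V !=set0 -> V p.
Proof.
move=> UT nt can.
pose c a : spec_sec U := SpecSec (@locally_fraction_cst A U a 1 (@spec1 A)).
have cD a b : c (a + b) = c a + c b.
  apply: spec_sec_inj => p hp; rewrite [RHS]loc_addE.
  by apply: frac_eq => /=; ring.
have cM a b : c (a * b) = c a * c b.
  apply: spec_sec_inj => p hp; rewrite [RHS]loc_mulE.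
  by apply: frac_eq => /=; ring.
have prime0 : is_prime [set a | c a = 0].
  split.
  - split=> [//|a b /= a0 b0|a b /= b0]; first by rewrite cD a0 b0 addr0.
    by rewrite cM b0 mulr0.
  - by move=> /seteqP[_ /(_ 1 I)] /nt.
  - move=> a b /= ab; case: (pselect (c a = 0)) => a0; [by left|right].
    by apply: (can _ a0); rewrite mulr0 -cM.
exists (SpecPoint prime0) => _ [E ->] [q /= /existsNP[a /not_implyP[Ea qa]]].
move=> /(_ a Ea) /= /(congr1 (fun s => sfun s (UT q))) /= /fracP[u [qu]] /=.
rewrite mulr1 mul0r mulr0 => e; apply: (specM qu qa); rewrite e.
by case: (psetP q) => -[].
Qed.

Lemma generic_exists : exists x : Y, is_generic x.
Proof.
have [[y _] can] := hY; have [_ /(_ y)[A [j [[injj opj bij] jy]]]] := schemeP Y.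
pose W := Opens (opj setT openT).
have W0 : W !=set0 by exists y.
have [g gK Kg] := bij W (fun _ h => h).
pose U := opens_preim (mor_cont j) W.
have UT p : U p by exists p.
have nt : (1 : sheafO (Spec A) U) <> 0.
  move=> e; apply: (sections_nontrivial W0); apply: (can_inj gK).
  by rewrite rmorph1 rmorph0.
have canU : cancellative (sheafO (Spec A) U).
  move=> f f0 a b e; rewrite -[a]Kg -[b]Kg; congr (pull j W _).
  apply: (can W W0 (g f)) => [e0|]; first by apply: f0; rewrite -[f]Kg e0 rmorph0.
  by apply: (can_inj gK); rewrite !rmorphM !Kg.
have [p hp] := spec_generic UT nt canU.
exists (j p); apply/seteqP; split=> // z _ B.
rewrite nbhsE => -[V [oV Vz] VB]; exists (j p); split=> //; apply: VB.
have [|//|x [Vx [w _ jw]]] := @scheme_irreducible (Opens oV) W.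
  by exists z.
apply: (hp (opens_preim (mor_cont j) (Opens oV))); first exact: openO.
by exists w; change (V (j w)); rewrite jw.
Qed.

Definition generic_point : Y := projT1 (cid generic_exists).

Lemma generic_pointP : is_generic generic_point.
Proof. exact: projT2 (cid generic_exists). Qed.
End GenericPoint.

Section CartierDivisors.
Variables (Y : scheme) (hY : is_cancellative Y).
Let eta := generic_point hY.

Definition function_field := stalk (sheafO Y) eta.

(* The image of the units of the local semiring at y in the units of the
   function field. *)
Definition local_unit (y : Y) (f : units function_field) : Prop :=
  exists (U : opens Y) (hy : U y) (he : U eta) (u : units (sheafO Y U)),
    uval f = germ (sheafO Y) he (uval u).

Definition local_units (y : Y) : {pred units function_field} :=
  [pred f | `[< local_unit y f >]].

Fact local_units_closed (y : Y) : zmod_closed (local_units y).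
Proof.
split=> [|f g].
  apply/asboolP; exists (opensT Y), I, I, 0.
  exact: esym (germ1 _ _).
move=> /asboolP[U [Uy [Ue [u fu]]]] /asboolP[V [Vy [Ve [v gv]]]].
apply/asboolP.
have hy : opensI U V y by split.
have he : opensI U V eta by split.
pose ru := res (sheafO Y) (@opensIl _ U V).
pose rv := res (sheafO Y) (@opensIr _ U V).
have ruK : ru (uval u) * ru (uinv u) = 1 by rewrite -rmorphM uvalK rmorph1.
have rvK : rv (uval v) * rv (uinv v) = 1 by rewrite -rmorphM uvalK rmorph1.
exists (opensI U V), hy, he, (Units ruK - Units rvK).
rewrite /= germM germ_res -fu; congr (_ * _).
have e : uval g * germ (sheafO Y) he (rv (uinv v)) = 1.
  by rewrite gv -(germ_res Ve he (@opensIr _ U V)) -germM rvK germ1.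
rewrite -[LHS]mulr1 -e mulrA [uinv g * _]mulrC uvalK.
exact: mul1r.
Qed.

HB.instance Definition _ (y : Y) :=
  GRing.isZmodClosed.Build _ (local_units y) (local_units_closed y).

(* The stalk at y of the quotient of the constant sheaf of units of the
   function field by the sheaf of units of the structure sheaf, i.e. the
   quotient of the two stalks. *)
Definition cart_stalk (y : Y) : zmodType := Quotient.quot (local_units y).

Definition cart_class (y : Y) (f : units function_field) : cart_stalk y :=
  \pi_(Quotient.quot (local_units y)) f.

(* Global sections of the quotient sheaf, the sheaf associated with the
   presheaf of quotients: families of elements of the stalks that are locally
   the classes of a section of the constant sheaf. *)
Definition cart_local (D : forall y : Y, cart_stalk y) : Prop :=
  forall y, exists (U : opens Y) (f : units function_field),
    U y /\ forall z, U z -> D z = cart_class z f.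

Record cart := Cartier {
  cart_fun :> forall y : Y, cart_stalk y; cartP : cart_local cart_fun }.

Lemma cart_inj (D E : cart) : (forall y, D y = E y) -> D = E.
Proof.
case: D E => [D hD] [E hE] /= e.
have {}e : D = E by apply: functional_extensionality_dep.
by subst E; congr Cartier; apply: Prop_irrelevance.
Qed.

HB.instance Definition _ := gen_eqMixin cart.
HB.instance Definition _ := gen_choiceMixin cart.

Lemma cart_classB (y : Y) f g :
  cart_class y (f - g) = cart_class y f - cart_class y g.
Proof. by rewrite /cart_class !piE. Qed.
Lemma cart_classD (y : Y) f g :
  cart_class y (f + g) = cart_class y f + cart_class y g.
Proof. by rewrite /cart_class !piE. Qed.
Lemma cart_class0 (y : Y) : cart_class y 0 = 0.
Proof. by rewrite /cart_class !piE. Qed.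
Lemma cart_classN (y : Y) f : cart_class y (- f) = - cart_class y f.
Proof. by rewrite /cart_class !piE. Qed.

Fact principal_local (f : units function_field) :
  cart_local (fun y => cart_class y f).
Proof. by move=> y; exists (opensT Y), f. Qed.

Definition cart_div (f : units function_field) : cart :=
  Cartier (principal_local f).

Fact cart_add_local (D E : cart) : cart_local (fun y => D y + E y).
Proof.
move=> y; have [U [f [Uy e]]] := cartP D y; have [V [g [Vy e']]] := cartP E y.
exists (opensI U V), (f + g); split=> [|z [Uz Vz]]; first by split.
by rewrite cart_classD e ?e'.
Qed.
Definition cart_add D E := Cartier (cart_add_local D E).

Fact cart_opp_local (D : cart) : cart_local (fun y => - D y).
Proof.
move=> y; have [U [f [Uy e]]] := cartP D y.
by exists U, (- f); split=> // z Uz; rewrite cart_classN e.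
Qed.
Definition cart_opp D := Cartier (cart_opp_local D).

Fact cart_addA : associative cart_add.
Proof. by move=> a b c; apply: cart_inj => y /=; rewrite addrA. Qed.
Fact cart_addC : commutative cart_add.
Proof. by move=> a b; apply: cart_inj => y /=; rewrite addrC. Qed.
Fact cart_add0 : left_id (cart_div 0) cart_add.
Proof. by move=> a; apply: cart_inj => y /=; rewrite cart_class0 add0r. Qed.
Fact cart_addN : left_inverse (cart_div 0) cart_opp cart_add.
Proof. by move=> a; apply: cart_inj => y /=; rewrite cart_class0 addNr. Qed.

HB.instance Definition _ := GRing.isZmodule.Build cart
  cart_addA cart_addC cart_add0 cart_addN.

Definition principal : {pred cart} :=
  [pred D | `[< exists f, D = cart_div f >]].

Fact principal_closed : zmod_closed principal.
Proof.
split=> [|_ _ /asboolP[f ->] /asboolP[g ->]]; first by apply/asboolP; exists 0.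
apply/asboolP; exists (f - g); apply: cart_inj => y /=.
by rewrite cart_classB.
Qed.

HB.instance Definition _ :=
  GRing.isZmodClosed.Build _ principal principal_closed.

Definition CaCl : zmodType := Quotient.quot principal.
End CartierDivisors.

Record omodule (Y : srspace) := OModule {
  msec :> forall U : opens Y, lSemiModType (sheafO Y U);
  mres : forall U V : opens Y, V `<=` U -> {additive msec U -> msec V};
  mresZ : forall (U V : opens Y) (h : V `<=` U) (a : sheafO Y U) (m : msec U),
    mres h (a *: m) = res (sheafO Y) h a *: mres h m;
  msheafP : is_sheaf (fun U V h => mres h : msec U -> msec V) }.
Arguments mres {Y} o {U V} _.

(* Morphisms from the restriction of L to U to the restriction of M to U. *)
Record omodule_hom (Y : srspace) (U : opens Y) (L M : omodule Y) := OModuleHom {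
  hom_sec : forall V : opens Y, V `<=` U -> {linear L V -> M V};
  hom_res : forall (V W : opens Y) (hV : V `<=` U) (hW : W `<=` U)
    (h : W `<=` V) (s : L V),
    hom_sec hW (mres L h s) = mres M h (hom_sec hV s) }.

Definition isomorphic_on (Y : srspace) (U : opens Y) (L M : omodule Y) : Prop :=
  exists f : omodule_hom U L M,
    forall (V : opens Y) (hV : V `<=` U), bijective (hom_sec f hV).

Definition isomorphic (Y : srspace) (L M : omodule Y) : Prop :=
  isomorphic_on (opensT Y) L M.

Section StructureModule.
Variable Y : srspace.
Let sec1 (U : opens Y) : lSemiModType (sheafO Y U) := (sheafO Y U)^o.
Let res1 (U V : opens Y) (h : V `<=` U) : {additive sec1 U -> sec1 V} :=
  res (sheafO Y) h.
Fact res1Z (U V : opens Y) (h : V `<=` U) (a : sheafO Y U) (m : sec1 U) :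
  res1 h (a *: m) = res (sheafO Y) h a *: res1 h m.
Proof. exact: rmorphM. Qed.
Definition omodule1 : omodule Y := OModule res1Z (sheafP (sheafO Y)).
End StructureModule.

Definition invertible (Y : srspace) (L : omodule Y) : Prop :=
  forall y : Y, exists U : opens Y, U y /\ isomorphic_on U L (omodule1 Y).

(* Bilinear over the structure sheaf; biadditivity at 0 follows from bilZl and
   bilZr with a = 0. *)
Record obilinear (Y : srspace) (L M P : omodule Y) := OBilinear {
  bil_sec :> forall U : opens Y, L U -> M U -> P U;
  bilDl : forall (U : opens Y) (x x' : L U) (y : M U),
    bil_sec (x + x') y = bil_sec x y + bil_sec x' y;
  bilDr : forall (U : opens Y) (x : L U) (y y' : M U),
    bil_sec x (y + y') = bil_sec x y + bil_sec x y';
  bilZl : forall (U : opens Y) (a : sheafO Y U) (x : L U) (y : M U),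
    bil_sec (a *: x) y = a *: bil_sec x y;
  bilZr : forall (U : opens Y) (a : sheafO Y U) (x : L U) (y : M U),
    bil_sec x (a *: y) = a *: bil_sec x y;
  bil_res : forall (U V : opens Y) (h : V `<=` U) (x : L U) (y : M U),
    bil_sec (mres L h x) (mres M h y) = mres P h (bil_sec x y) }.

(* The tensor product of L and M over the structure sheaf, defined up to unique
   isomorphism by its universal property. *)
Definition is_tensor (Y : srspace) (L M N : omodule Y) : Prop :=
  exists t : obilinear L M N, forall (P : omodule Y) (b : obilinear L M P),
  exists g : omodule_hom (opensT Y) N P,
    (forall (U : opens Y) x y, hom_sec g (@subopensT _ U) (t U x y) = b U x y) /\
    (forall g' : omodule_hom (opensT Y) N P,
       (forall (U : opens Y) x y,
          hom_sec g' (@subopensT _ U) (t U x y) = b U x y) ->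
       forall (U : opens Y) z,
         hom_sec g' (@subopensT _ U) z = hom_sec g (@subopensT _ U) z).

(* An isomorphism class is represented by the collection of its members. *)
Record Pic (Y : srspace) := PicClass {
  pic_class :> omodule Y -> Prop;
  picP : exists L, invertible L /\ pic_class = isomorphic L }.

(* c is the product of a and b in the Picard group: for L in a and M in b, its
   members are the tensor products of L and M. *)
Definition is_pic_mul (Y : srspace) (a b c : Pic Y) : Prop :=
  forall L M N : omodule Y, a L -> b M -> (c N <-> is_tensor L M N).

(* Main.v *)
From HB Require Import structures.
From mathcomp Require Import all_boot all_algebra.
From mathcomp Require Import all_classical.
From mathcomp Require Import topology_structure ring.
Require Import Defs.
Import GRing.Theory.

(** Let eta be the generic point of X and F = O_{X,eta}.  A Cartier divisor D
with local equations f_y has a sheaf O(D) of fractional ideals inside the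
constant sheaf F, with stalk f_y^-1 O_{X,y} at y; the isomorphism sends the
class of D to the class of O(D).

Everything rests on one consequence of cancellativity: taking germs at eta is
injective on the sections over any nonempty open set ([germ_generic_inj]).  On
an affine chart, near any given point, two sections are fractions a/f and b/g;
if they agree somewhere in the domain of these fractions, then u a g = u b f for
some u that is nonzero as a section there, and u cancels.  By gluing, a section
of O_X over a nonempty U is therefore the same thing as an element of F that is
regular at every point of U
([section_of_regular]), and f^-1 generates O(D) wherever f is an equation of D
([div_generator]); in particular O(D) is invertible.

- Injectivity: a morphism O(D) -> O(E) is multiplication by an element of F,
  which can be read off at eta ([hom_is_mul]); that of an isomorphism is a unit
  c, and comparing the fractional ideals gives D = E + div(c)
  ([divisor_module_isoP]).
- Surjectivity: dividing by a generator of L near eta embeds an invertible L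
  into the constant sheaf F.  The images of local generators of L are units of
  F, unique up to local units of O_X; their inverses are local equations of a
  divisor D with L = O(D) ([divisor_of_invertible]).  This replaces the
  vanishing of H^1 of the constant sheaf of units of F.
- Additivity: a bilinear map that sends pairs of local generators to local
  generators is a tensor product ([tensor_of_generators]), and multiplication
  in F is such a map from O(D) and O(E) to O(D + E) ([divisor_tensor]). *)

Set Implicit Arguments.
Unset Strict Implicit.
Unset Printing Implicit Defensive.

Local Open Scope classical_set_scope.
Local Open Scope ring_scope.
Local Open Scope quotient_scope.

(** * Gluing sections of sheaves *)

Lemma bij_of_inj_surj (A B : Type) (f : A -> B) :
  injective f -> (forall b, exists a, f a = b) -> bijective f.
Proof.
move=> finj fsur; exists (fun b => sval (cid (fsur b))) => [a|b].
  by apply: finj; case: cid.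
by case: cid.
Qed.

Section Gluing.
Variables (X : topologicalType) (F : opens X -> Type).
Variable r : forall U V : opens X, V `<=` U -> F U -> F V.
Hypothesis sheafF : is_sheaf r.

Lemma sheaf_separated (U : opens X) (s t : F U) :
  (forall y, U y -> exists (V : opens X) (h : V `<=` U),
     V y /\ r h s = r h t) -> s = t.
Proof.
move=> loc; have [_ _ sep _] := sheafF.
(* Taking all suitable V as the cover avoids choosing one for each y. *)
pose I := {V : opens X | exists h : V `<=` U, r h s = r h t}.
have hI (i : I) : sval i `<=` U by case: i => V [].
apply: (sep U I (fun i => sval i) hI) => [y /loc[V [h [Vy e]]]|].
  by exists (exist _ V (ex_intro _ h e)).
case=> V [h e] /=; move: (hI _) => /= k.
by rewrite (Prop_irrelevance k h).
Qed.

(** Gluing without a chosen cover: P singles out the pieces of the section to be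
built.  As P has at most one solution on each open set, the pieces agree on
overlaps. *)
Lemma sheaf_glue (U : opens X) (P : forall V : opens X, F V -> Prop) :
  (forall (V W : opens X) (h : W `<=` V) s, V `<=` U -> P V s -> P W (r h s)) ->
  (forall (V : opens X) s t, V `<=` U -> P V s -> P V t -> s = t) ->
  (forall y, U y -> exists V : opens X, [/\ V `<=` U, V y & exists s, P V s]) ->
  exists t : F U, forall (V : opens X) (h : V `<=` U) s, P V s -> r h t = s.
Proof.
move=> Pr Pu Pex; have [_ _ _ glue] := sheafF.
pose I := {V : opens X | V `<=` U /\ exists s, P V s}.
have hI (i : I) : sval i `<=` U by case: i => V [].
have sI (i : I) : exists s, P (sval i) s by case: i => V [].
pose s i := sval (cid (sI i)).
have sP i : P (sval i) (s i) := svalP (cid (sI i)).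
have [||t et] := glue U I (fun i => sval i) hI _ s.
- by move=> y /Pex[V [VU Vy ex]]; exists (exist _ V (conj VU ex)).
- move=> i j W hi hj; apply: Pu; first exact: subset_trans hi (hI i).
    exact: Pr.
  exact: Pr.
exists t => V h u Pu'; pose i : I := exist _ V (conj h (ex_intro _ u Pu')).
have Pt : P V (r (hI i) t) by have := sP i; rewrite -et.
by apply: (Pu _ _ _ h _ Pu'); rewrite (Prop_irrelevance h (hI i)).
Qed.
End Gluing.

(** * Modules over the structure sheaf: generators, gluing and tensor products *)

Section Modules.
Variable Y : srspace.
Implicit Types (U V W : opens Y) (L M N P : omodule Y).

Lemma mres_id L U (h : U `<=` U) (s : L U) : mres L h s = s.
Proof. by case: (msheafP L) => h0 _ _ _; apply: h0. Qed.

Lemma mres_comp L U V W (hV : V `<=` U) (hW : W `<=` V) (hWU : W `<=` U)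
  (s : L U) : mres L hW (mres L hV s) = mres L hWU s.
Proof. by case: (msheafP L) => _ h _ _; apply: h. Qed.

(** In a semimodule a map that preserves sums and multiples preserves 0, the
multiple by 0. *)
Definition mk_linear (R : pzSemiRingType) (L M : lSemiModType R) (g : L -> M)
    (gZ : forall a x, g (a *: x) = a *: g x)
    (gD : forall x y, g (x + y) = g x + g y) : {linear L -> M} :=
  HB.pack g (GRing.isSemilinear.Build R L M *:%R g (gZ, gD)).

Definition hom_id L : omodule_hom (opensT Y) L L.
Proof.
by apply: (@OModuleHom _ _ _ _ (fun V _ => idfun : {linear _ -> _})).
Defined.

Definition hom_comp U L M N (g : omodule_hom U M N) (f : omodule_hom U L M) :
  omodule_hom U L N.
Proof.
apply: (@OModuleHom _ _ _ _
  (fun V h => hom_sec g h \o hom_sec f h : {linear _ -> _})) => V W hV hW h s.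
by rewrite /= (hom_res f hV hW) (hom_res g hV hW).
Defined.

Lemma hom_inv U L M (f : omodule_hom U L M)
  (bij : forall (V : opens Y) (h : V `<=` U), bijective (hom_sec f h)) :
  exists g : omodule_hom U M L, forall V (h : V `<=` U),
    cancel (hom_sec f h) (hom_sec g h) /\ cancel (hom_sec g h) (hom_sec f h).
Proof.
have ex V (h : V `<=` U) (m : M V) : exists s, hom_sec f h s = m.
  by have [g _ gK] := bij V h; exists (g m).
pose g V (h : V `<=` U) (m : M V) : L V := sval (cid (ex V h m)).
have gK V (h : V `<=` U) : cancel (@g V h) (hom_sec f h).
  by move=> m; apply: (svalP (cid (ex V h m))).
have fI V h := bij_inj (bij V h).
have gZ V (h : V `<=` U) a x : g V h (a *: x) = a *: g V h x.
  by apply: (fI V h); rewrite linearZ !gK.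
have gD V (h : V `<=` U) x y : g V h (x + y) = g V h x + g V h y.
  by apply: (fI V h); rewrite linearD !gK.
have gr V W (hV : V `<=` U) (hW : W `<=` U) (h : W `<=` V) s :
    mk_linear (gZ W hW) (gD W hW) (mres M h s) =
    mres L h (mk_linear (gZ V hV) (gD V hV) s).
  by apply: (fI W hW); rewrite gK (hom_res f hV hW) gK.
exists (OModuleHom gr) => V h; split; last exact: gK.
exact: inj_can_sym (gK V h) (fI V h).
Qed.

Lemma isomorphic_refl L : isomorphic L L.
Proof. by exists (hom_id L) => V h; exists id. Qed.

Lemma isomorphic_sym L M : isomorphic L M -> isomorphic M L.
Proof.
move=> [f /hom_inv[g gf]]; exists g => V h; have [fK gK] := gf V h.
by exists (hom_sec f h).
Qed.

Lemma isomorphic_trans L M N : isomorphic L M -> isomorphic M N -> isomorphic L N.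
Proof.
move=> [f fb] [g gb]; exists (hom_comp g f) => V h.
exact: bij_comp (gb V h) (fb V h).
Qed.

Definition generator L U (e : L U) : Prop :=
  forall V (h : V `<=` U) (s : L V), exists! a, s = a *: mres L h e.

Lemma generator_res L U V (h : V `<=` U) (e : L U) :
  generator e -> generator (mres L h e).
Proof.
move=> ge W k s; have [a [ea ua]] := ge W (subset_trans k h) s.
by exists a; rewrite (mres_comp _ _ (subset_trans k h)).
Qed.

Lemma generator_inj L U (e : L U) V (h : V `<=` U) (a b : sheafO Y V) :
  generator e -> a *: mres L h e = b *: mres L h e -> a = b.
Proof.
move=> ge eab; have [c [_ uc]] := ge V h (a *: mres L h e).
by rewrite -(uc a erefl) -(uc b eab).
Qed.

Lemma generator_iso L M U (f : omodule_hom (opensT Y) L M) (e : L U) :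
  (forall V (h : V `<=` opensT Y), bijective (hom_sec f h)) ->
  generator e -> generator (hom_sec f (@subopensT _ U) e).
Proof.
move=> /hom_inv[g gf] ge V h s.
have [fK gK] := gf V (@subopensT _ V).
have [a [ea ua]] := ge V h (hom_sec g (@subopensT _ V) s).
have er : mres M h (hom_sec f (@subopensT _ U) e) =
          hom_sec f (@subopensT _ V) (mres L h e).
  by rewrite -(hom_res f _ (@subopensT _ V)).
exists a; split=> [|b]; first by rewrite er -linearZ -ea gK.
by rewrite er -linearZ => es; apply: ua; rewrite es fK.
Qed.

(** The map sends a section to its coordinate with respect to e, times m. *)
Lemma generator_hom L M U (e : L U) (m : M U) : generator e ->
  exists g : omodule_hom U L M, forall V (h : V `<=` U) a,
    hom_sec g h (a *: mres L h e) = a *: mres M h m.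
Proof.
move=> ge.
have ex V (h : V `<=` U) (s : L V) : exists a, s = a *: mres L h e.
  by have [a [ea _]] := ge V h s; exists a.
pose c V (h : V `<=` U) (s : L V) := sval (cid (ex V h s)).
have cK V (h : V `<=` U) s : s = c V h s *: mres L h e.
  exact: (svalP (cid (ex V h s))).
have cE V (h : V `<=` U) a : c V h (a *: mres L h e) = a.
  by apply: (generator_inj ge); rewrite -cK.
pose g V (h : V `<=` U) (s : L V) : M V := c V h s *: mres M h m.
have gZ V (h : V `<=` U) a x : g V h (a *: x) = a *: g V h x.
  by rewrite /g {1}(cK V h x) scalerA cE scalerA.
have gD V (h : V `<=` U) x y : g V h (x + y) = g V h x + g V h y.
  by rewrite /g {1}(cK V h x) {1}(cK V h y) -scalerDl cE scalerDl.
have gr V W (hV : V `<=` U) (hW : W `<=` U) (h : W `<=` V) s :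
    mk_linear (gZ W hW) (gD W hW) (mres L h s) =
    mres M h (mk_linear (gZ V hV) (gD V hV) s).
  rewrite /= /g {1}(cK V hV s) !mresZ (mres_comp _ _ hW) (mres_comp _ _ hW).
  by rewrite cE.
by exists (OModuleHom gr) => V h a /=; rewrite /g cE.
Qed.

(** A trivialization of L over U is the choice of the section that it sends to
1. *)
Lemma generator_iso1 L U : isomorphic_on U L (omodule1 Y) <->
  exists e : L U, generator e.
Proof.
split=> [[f /hom_inv[g gf]]|[e ge]].
  have hU : U `<=` U by [].
  exists (hom_sec g hU (1 : sheafO Y U)) => V h s.
  have er : mres L h (hom_sec g hU (1 : sheafO Y U)) = hom_sec g h (1 : sheafO Y V).
    rewrite -(hom_res g hU h h); congr (hom_sec g h _).
    exact: (rmorph1 (res (sheafO Y) h)).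
  have [fK gK] := gf V h.
  have aE (a : sheafO Y V) : a *: hom_sec g h (1 : sheafO Y V) = hom_sec g h a.
    by rewrite -linearZ; congr (hom_sec g h _); apply: (mulr1 a).
  exists (hom_sec f h s); rewrite er; split=> [|b]; first by rewrite aE fK.
  by rewrite aE => ->; rewrite gK.
have [f fE] := generator_hom (M := omodule1 Y) (1 : sheafO Y U) ge.
have aE V (h : V `<=` U) (a : sheafO Y V) : hom_sec f h (a *: mres L h e) = a.
  rewrite fE; have -> : mres (omodule1 Y) h 1 = 1.
    exact: (rmorph1 (res (sheafO Y) h)).
  exact: (mulr1 a).
exists f => V h; exists (fun a => a *: mres L h e) => [s|a]; last exact: aE.
by have [a [-> _]] := ge V h s; rewrite aE.
Qed.

Lemma generator_units L U (e e' : L U) :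
  generator e -> generator e' -> exists u : units (sheafO Y U), e' = uval u *: e.
Proof.
move=> ge ge'; have hU : U `<=` U by [].
have [a [ea _]] := ge U hU e'; have [b [eb _]] := ge' U hU e.
rewrite mres_id in ea; rewrite mres_id in eb.
have ab : a * b = 1.
  by apply: (generator_inj (h := hU) ge'); rewrite mres_id scale1r -scalerA -eb.
by exists (Units ab).
Qed.

(** Morphisms of modules form a sheaf.  The predicate Q stands for a cover by
open sets together with the morphism chosen on each of them. *)
Lemma hom_glue L M (Q : forall U, omodule_hom U L M -> Prop) :
  (forall y : Y, exists U (g : omodule_hom U L M), U y /\ Q U g) ->
  (forall U U' (g : omodule_hom U L M) (g' : omodule_hom U' L M) W
     (h : W `<=` U) (h' : W `<=` U') s, Q U g -> Q U' g' ->
     hom_sec g h s = hom_sec g' h' s) ->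
  exists G : omodule_hom (opensT Y) L M,
    forall U (g : omodule_hom U L M) W (h : W `<=` U) s, Q U g ->
      hom_sec G (@subopensT _ W) s = hom_sec g h s.
Proof.
move=> cov agree.
pose P W (s : L W) V (p : M V) := exists U (g : omodule_hom U L M)
  (h : V `<=` U) (k : V `<=` W), Q U g /\ p = hom_sec g h (mres L k s).
have glue W (s : L W) : exists t : M W, forall V (h : V `<=` W) p,
    P W s V p -> mres M h t = p.
  apply: (sheaf_glue (msheafP M)).
  - move=> V V' h p _ [U [g [hU [k [Qg ->]]]]].
    exists U, g, (subset_trans h hU), (subset_trans h k); split=> //.
    by rewrite -(hom_res g hU (subset_trans h hU)) (mres_comp _ _ (subset_trans h k)).
  - move=> V p p' _ [U [g [hU [k [Qg ->]]]]] [U' [g' [hU' [k' [Qg' ->]]]]].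
    rewrite (agree _ _ g g' _ hU hU' _ Qg Qg'); congr (hom_sec g' hU' _).
    by congr (mres L _ _); apply: Prop_irrelevance.
  - move=> y Wy; have [U [g [Uy Qg]]] := cov y.
    exists (opensI U W); split=> //; first exact: opensIr.
    exists (hom_sec g (@opensIl _ U W) (mres L (@opensIr _ U W) s)).
    by exists U, g, (@opensIl _ U W), (@opensIr _ U W).
pose G W s := sval (cid (glue W s)).
have GP W s V (h : V `<=` W) p : P W s V p -> mres M h (G W s) = p.
  exact: (svalP (cid (glue W s))).
have GE U (g : omodule_hom U L M) W V (h : V `<=` W) (k : V `<=` U) s :
    Q U g -> mres M h (G W s) = hom_sec g k (mres L h s).
  by move=> Qg; apply: GP; exists U, g, k, h.
(* Equalities over W may be checked on the members of the cover inside W. *)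
have loc W (p p' : M W) :
    (forall U (g : omodule_hom U L M) V (h : V `<=` W) (k : V `<=` U), Q U g ->
      mres M h p = mres M h p') -> p = p'.
  move=> e; apply: (sheaf_separated (msheafP M)) => y Wy.
  have [U [g [Uy Qg]]] := cov y.
  exists (opensI U W), (@opensIr _ U W); split=> //.
  exact: e U g _ _ (@opensIl _ U W) Qg.
have GZ W a x : G W (a *: x) = a *: G W x.
  apply: loc => U g V h k Qg.
  by rewrite mresZ (GE _ _ _ _ _ k _ Qg) (GE _ _ _ _ _ k _ Qg) mresZ linearZ.
have GD W x y : G W (x + y) = G W x + G W y.
  apply: loc => U g V h k Qg.
  by rewrite raddfD !(GE _ _ _ _ _ k _ Qg) raddfD linearD.
have Gr V W (hV : V `<=` opensT Y) (hW : W `<=` opensT Y) (h : W `<=` V) s :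
    mk_linear (GZ W) (GD W) (mres L h s) =
    mres M h (mk_linear (GZ V) (GD V) s).
  apply: loc => U g T k l Qg /=.
  rewrite (GE _ _ _ _ _ l _ Qg) (mres_comp _ _ (subset_trans k h)).
  by rewrite (mres_comp _ _ (subset_trans k h)) (GE _ _ _ _ _ l _ Qg).
exists (OModuleHom Gr) => U g W h s Qg /=.
have hW : W `<=` W by [].
by rewrite -[G W s](mres_id hW) (GE _ _ _ _ _ h _ Qg) mres_id.
Qed.

(** Where L and M have generators x and z, a bilinear map b has to factor through
the morphism sending the generator t(x, z) to b(x, z).  This morphism does
satisfy g(t(x', z')) = b(x', z') for all x' and z', a condition in which the
generators no longer appear, so that the local solutions agree and glue. *)
Lemma tensor_of_generators L M N (t : obilinear L M N) :
  (forall y : Y, exists U (x : L U) (z : M U),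
     [/\ U y, generator x, generator z & generator (t U x z)]) ->
  is_tensor L M N.
Proof.
move=> gen; exists t => P b.
(* The second half makes N spanned on U by the t x z, whence uniqueness. *)
pose Q U (g : omodule_hom U N P) := (forall V (h : V `<=` U) x z,
    hom_sec g h (t V x z) = b V x z) /\
  exists (x : L U) (z : M U), generator (t U x z).
have cov y : exists U (g : omodule_hom U N P), U y /\ Q U g.
  have [U [x [z [Uy gx gz gt]]]] := gen y.
  have [g gE] := generator_hom (b U x z) gt.
  exists U, g; split=> //; split; last by exists x, z.
  move=> V h x' z'; have [a [-> _]] := gx V h x'; have [c [-> _]] := gz V h z'.
  by rewrite !(bilZl, bilZr) !bil_res scalerA gE -scalerA.
have [|G GE] := hom_glue cov.
  move=> U U' g g' W h h' s [gt [x [z gxz]]] [gt' _].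
  have [a [-> _]] := gxz W h s.
  by rewrite -bil_res !linearZ gt gt'.
have Gt U (x : L U) z : hom_sec G (@subopensT _ U) (t U x z) = b U x z.
  apply: (sheaf_separated (msheafP P)) => y Uy; have [V [g [Vy Qg]]] := cov y.
  exists (opensI V U), (@opensIr _ V U); split=> //.
  rewrite -(hom_res G _ (@subopensT _ _)) (GE _ _ _ (@opensIl _ V U) _ Qg).
  by rewrite -!bil_res; case: Qg => ->.
exists G; split=> // G' G't U s.
apply: (sheaf_separated (msheafP P)) => y Uy.
have [V [x [z [Vy _ _ gt]]]] := gen y.
exists (opensI V U), (@opensIr _ V U); split=> //.
rewrite -(hom_res G _ (@subopensT _ _)) -(hom_res G' _ (@subopensT _ _)).
have [a [-> _]] := gt _ (@opensIl _ V U) (mres N (@opensIr _ V U) s).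
by rewrite -bil_res !linearZ Gt G't.
Qed.

Lemma tensor_unique L M N N' :
  is_tensor L M N -> is_tensor L M N' -> isomorphic N N'.
Proof.
move=> [t tU] [t' tU'].
have [g [gE _]] := tU N' t'; have [g' [gE' _]] := tU' N t.
have gg' U s : hom_sec g' (@subopensT _ U) (hom_sec g (@subopensT _ U) s) = s.
  have [i [_ iU]] := tU N t; transitivity (hom_sec i (@subopensT _ U) s).
    by apply: (iU (hom_comp g' g)) => V x z /=; rewrite gE gE'.
  by apply/esym; apply: (iU (hom_id N)).
have g'g U s : hom_sec g (@subopensT _ U) (hom_sec g' (@subopensT _ U) s) = s.
  have [i [_ iU]] := tU' N' t'; transitivity (hom_sec i (@subopensT _ U) s).
    by apply: (iU (hom_comp g g')) => V x z /=; rewrite gE' gE.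
  by apply/esym; apply: (iU (hom_id N')).
exists g => V h; rewrite (Prop_irrelevance h (@subopensT _ V)).
by exists (hom_sec g' (@subopensT _ V)); [apply: gg'|apply: g'g].
Qed.

Definition transport_bilinear L M N L' M' N' (b : obilinear L' M' N')
    (i : omodule_hom (opensT Y) L L') (j : omodule_hom (opensT Y) M M')
    (k : omodule_hom (opensT Y) N' N) : obilinear L M N.
Proof.
apply: (@OBilinear _ _ _ _ (fun U x y => hom_sec k (@subopensT _ U)
  (b U (hom_sec i (@subopensT _ U) x) (hom_sec j (@subopensT _ U) y)))).
- by move=> U x x' y; rewrite linearD bilDl linearD.
- by move=> U x y y'; rewrite linearD bilDr linearD.
- by move=> U a x y; rewrite linearZ bilZl linearZ.
- by move=> U a x y; rewrite linearZ bilZr linearZ.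
- move=> U V h x y.
  rewrite (hom_res i (@subopensT _ U)) (hom_res j (@subopensT _ U)) bil_res.
  by rewrite (hom_res k (@subopensT _ U)).
Defined.
End Modules.

(** * Germs at the generic point *)

Lemma cancellative_bij (A B : comPzSemiRingType) (f : {rmorphism A -> B}) :
  bijective f -> cancellative A -> cancellative B.
Proof.
move=> [g gK Kg] canA c c0 a b e; rewrite -[a]Kg -[b]Kg; congr (f _).
apply: (canA (g c)) => [e0|]; first by apply: c0; rewrite -[c]Kg e0 rmorph0.
by apply: (can_inj gK); rewrite !rmorphM !Kg.
Qed.

(** Fractions a/f and b/g that agree at one point q of Q agree at every point of
Q: equality at q means u a g = u b f with u not in q, hence u is nonzero as a
section over Q and can be cancelled. *)
Lemma spec_sec_identity (A : comPzSemiRingType) (Q : opens (spec A)) (q : spec A)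
    (a b : A) (f g : A) : cancellative (spec_sec Q) -> Q q ->
  forall (qf : ~ q f) (qg : ~ q g),
  frac (Fraction q a qf) = frac (Fraction q b qg) ->
  forall (p : spec A) (pf : ~ p f) (pg : ~ p g), Q p ->
  frac (Fraction p a pf) = frac (Fraction p b pg).
Proof.
move=> can Qq qf qg /fracP[u [qu /= e]] p pf pg Qp.
pose c x : spec_sec Q := SpecSec (@locally_fraction_cst A Q x 1 (@spec1 A)).
have cM x y : c (x * y) = c x * c y.
  apply: spec_sec_inj => r hr; rewrite [RHS]loc_mulE.
  by apply: frac_eq => /=; ring.
have cu : c u <> 0.
  move=> /(congr1 (fun s => sfun s Qq)) /= /fracP[v [qv]] /=.
  rewrite mulr1 mul0r mulr0 => e0; apply: (specM qv qu); rewrite e0.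
  by case: (psetP q) => -[].
have : c (a * g) = c (b * f) by apply: (can _ cu); rewrite -!cM e.
move=> /(congr1 (fun s => sfun s Qp)) /= /fracP[v [pv]] /=.
by rewrite !mulr1 => e'; apply/fracP; exists v.
Qed.

Section GenericStalk.
Variables (Y : scheme) (hY : is_cancellative Y).
Local Notation eta := (generic_point hY).
Local Notation F := (function_field hY).
Local Notation O := (sheafO Y).

Lemma generic_mem (U : opens Y) y : U y -> U eta.
Proof.
move=> Uy; have : closure [set eta] y by rewrite generic_pointP.
by move=> /(_ U (open_nbhs_nbhs (conj (openO U) Uy)))[_ [->]].
Qed.

(** It suffices to compare s and t near each point y.  On an affine chart around
y they are fractions a/f and b/g; the domain of these fractions meets W, as Y
is irreducible, so that they agree at some point, hence at y. *)
Lemma res_injective (U W : opens Y) (h : W `<=` U) (s t : O U) :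
  W !=set0 -> res O h s = res O h t -> s = t.
Proof.
move=> W0 est; apply: (sheaf_separated (sheafP O)) => y Uy.
have [_ /(_ y)[A [j [[injj opj bij] jy]]]] := schemeP Y.
pose V := opensI U (Opens (opj setT openT)).
exists V, (@opensIl _ _ _); split; first by split=> //; case: jy => p _ <-; exists p.
have jV : V `<=` range j by apply: opensIr.
have [g gK _] := bij V jV; apply: (can_inj gK) => {g gK}.
apply: spec_sec_inj => p hp.
set s' := pull j V _; set t' := pull j V _.
have [Q1 [hQ1 [a [f [Q1p e1]]]]] := sfunP s' hp.
have [Q2 [hQ2 [b [g [Q2p e2]]]]] := sfunP t' hp.
pose jQ := Opens (opj (opensI Q1 Q2) (openO _)).
have jQV : jQ `<=` V by move=> _ [q [Q1q _] <-]; exact: (hQ1 q Q1q).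
have jQ0 : jQ !=set0 by exists (j p), p.
have [_ [[q [Q1q Q2q] <-] Wq]] := scheme_irreducible hY jQ0 W0.
have est' : sfun s' (hQ1 q Q1q) = sfun t' (hQ1 q Q1q).
  have hI : opensI V W `<=` V by apply: opensIl.
  have hW : opensI V W `<=` W by apply: opensIr.
  have hq : opens_preim (mor_cont j) (opensI V W) q by split=> //; exact: (hQ1 q Q1q).
  have hI' : opens_preim (mor_cont j) (opensI V W) `<=` opens_preim (mor_cont j) V.
    by move=> r; apply: hI.
  have : res _ hI' s' = res _ hI' t'.
    rewrite -!(@pull_res _ _ j _ _ hI) !resE; congr (pull j _ _).
    transitivity (res O hW (res O h s)); first by rewrite resE; apply: res_irr.
    by rewrite est resE; apply: res_irr.
  move=> /(congr1 (fun r => sfun r hq)) /=.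
  by rewrite (Prop_irrelevance (hI' q hq) (hQ1 q Q1q)).
have [qf eqf] := e1 q Q1q; have [qg eqg] := e2 q Q2q.
have [pf epf] := e1 p Q1p; have [pg epg] := e2 p Q2p.
rewrite (Prop_irrelevance hp (hQ1 p Q1p)) epf.
rewrite (Prop_irrelevance (hQ1 p Q1p) (hQ2 p Q2p)) epg.
pose Q := opens_preim (mor_cont j) jQ.
have canQ : cancellative (spec_sec Q).
  apply: (cancellative_bij (bij jQ _) (hY.2 jQ jQ0)).
  exact: subset_trans jQV jV.
have Qq : Q q by exists q.
apply: (spec_sec_identity canQ Qq (qf := qf) (qg := qg)); last by exists p.
by rewrite -eqf -eqg est'; congr (sfun _ _); apply: Prop_irrelevance.
Qed.

Lemma germ_generic_inj (U : opens Y) (s t : O U) :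
  (forall he : U eta, germ O he s = germ O he t) -> s = t.
Proof.
move=> e; apply: (sheaf_separated (sheafP O)) => y Uy.
exists U, (fun=> id); split=> //; congr (res O _ _).
have he := generic_mem Uy; have /germP[W [h [k [We e']]]] := e he.
apply: (res_injective (h := h)); first by exists eta.
by rewrite e'; apply: res_irr.
Qed.

Definition regular_at (y : Y) (a : F) : Prop :=
  exists (U : opens Y) (hy : U y) (he : U eta) (s : O U), a = germ O he s.

Lemma regular_germ (U : opens Y) y (he : U eta) (s : O U) :
  U y -> regular_at y (germ O he s).
Proof. by move=> Uy; exists U, Uy, he, s. Qed.

Lemma regularD y a b : regular_at y a -> regular_at y b -> regular_at y (a + b).
Proof.
move=> [U [Uy [Ue [s ->]]]] [V [Vy [Ve [t ->]]]].
have he : opensI U V eta by split.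
rewrite -(germ_res Ue he (@opensIl _ U V)) -(germ_res Ve he (@opensIr _ U V)).
by rewrite -germD; apply: regular_germ.
Qed.

Lemma regularM y a b : regular_at y a -> regular_at y b -> regular_at y (a * b).
Proof.
move=> [U [Uy [Ue [s ->]]]] [V [Vy [Ve [t ->]]]].
have he : opensI U V eta by split.
rewrite -(germ_res Ue he (@opensIl _ U V)) -(germ_res Ve he (@opensIr _ U V)).
by rewrite -germM; apply: regular_germ.
Qed.

Lemma regular0 y : regular_at y 0.
Proof. by rewrite -(@germ0 _ O eta (opensT Y) I); apply: regular_germ. Qed.

(** Near each point the element is the germ of a section, and these sections agree
on overlaps because their germs at eta do.  The element of F is given as a
function of a proof that U contains eta, so that the empty U is covered too. *)
Lemma section_of_regular (U : opens Y) (a : U eta -> F) :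
  (forall y (he : U eta), U y -> regular_at y (a he)) ->
  exists s : O U, forall he : U eta, germ O he s = a he.
Proof.
move=> reg.
pose P (V : opens Y) (s : O V) :=
  forall (he : V eta) (he' : U eta), germ O he s = a he'.
have [|||s sP] := sheaf_glue (sheafP O) (U := U) (P := P).
- move=> V W h s _ Ps he he'; have heV := h _ he.
  by rewrite (germ_res heV he); apply: Ps.
- move=> V s t VU Ps Pt; apply: germ_generic_inj => he.
  by have he' := VU _ he; rewrite (Ps he he') (Pt he he').
- move=> y Uy; have [V [Vy [Ve [s e]]]] := reg y (generic_mem Uy) Uy.
  exists (opensI V U); split=> //; first exact: opensIr.
  exists (res O (@opensIl _ V U) s) => he he'.
  rewrite (germ_res Ve he) -e; congr (a _); exact: Prop_irrelevance.
exists s => he; have [V [Ve [Ve' [t e]]]] := reg eta he he.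
have heV : opensI V U eta by split.
rewrite -(germ_res he heV (@opensIr _ V U)).
rewrite (sP _ (@opensIr _ V U) (res O (@opensIl _ V U) t)) => [|he1 he2].
  by rewrite (germ_res Ve heV) e; congr (germ _ _ _); apply: Prop_irrelevance.
rewrite (germ_res Ve he1) (Prop_irrelevance he2 he) e.
by congr (germ _ _ _); apply: Prop_irrelevance.
Qed.

(** Sections near y with germs f and f^-1 at eta are inverse to each other,
because germs at eta determine their product. *)
Lemma local_unitP y (f : units F) :
  local_unit y f <-> regular_at y (uval f) /\ regular_at y (uinv f).
Proof.
split.
  move=> [U [Uy [Ue [u e]]]]; split; first by rewrite e; apply: regular_germ.
  have -> : uinv f = germ O Ue (uinv u); last exact: regular_germ.
  rewrite -[LHS]mulr1 -(@germ1 _ O eta U Ue) -(uvalK u) germM -e mulrA.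
  by rewrite [uinv f * _]mulrC uvalK mul1r.
move=> [[U [Uy [Ue [s es]]]] [V [Vy [Ve [t et]]]]].
have he : opensI U V eta by split.
pose s' := res O (@opensIl _ U V) s; pose t' := res O (@opensIr _ U V) t.
have st : s' * t' = 1.
  apply: germ_generic_inj => he'; rewrite germM (germ_res Ue) (germ_res Ve) germ1.
  by rewrite -es -et uvalK.
exists (opensI U V); have hy : opensI U V y by split.
by exists hy, he, (Units st); rewrite /= germ_res.
Qed.

End GenericStalk.

(** * The sheaf of fractional ideals of a Cartier divisor *)

Section DivisorSheaf.
Variables (Y : scheme) (hY : is_cancellative Y).
Local Notation eta := (generic_point hY).
Local Notation F := (function_field hY).
Local Notation O := (sheafO Y).
Implicit Types (U V W : opens Y) (D E : cart hY) (f g : units F).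

Lemma cart_class_eq y f g :
  cart_class y f = cart_class y g <-> local_unit y (f - g).
Proof.
rewrite /cart_class; split=> [/eqP|h]; last apply/eqP.
  by rewrite -Quotient.idealrBE => /asboolP.
by rewrite -Quotient.idealrBE; apply/asboolP.
Qed.

(** For a local equation f of D at y: a belongs to f^-1 O_{Y,y}, the stalk at y
of O(D). *)
Definition multiple_at D (y : Y) (a : F) : Prop :=
  exists f, D y = cart_class y f /\ regular_at y (uval f * a).

Lemma multiple_atE D y f a :
  D y = cart_class y f -> multiple_at D y a <-> regular_at y (uval f * a).
Proof.
move=> Df; split=> [[g [Dg reg]]|]; last by exists f.
have /cart_class_eq/local_unitP[fg _] : cart_class y f = cart_class y g.
  by rewrite -Df.
have -> : uval f * a = uval (f - g) * (uval g * a).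
  rewrite /= -mulrA; congr (_ * _); rewrite mulrA [uinv g * _]mulrC uvalK.
  by rewrite mul1r.
exact: regularM.
Qed.

(** The sections of O(D).  Nonempty open sets contain eta, so a function on the
proofs of [U eta] is an element of F when U is nonempty, while over the empty
set there is exactly one, as the sheaf condition demands. *)
Record div_section D U := DivSection {
  dval : U eta -> F;
  dvalP : forall y (he : U eta), U y -> multiple_at D y (dval he) }.

Section SectionModule.
Variables (D : cart hY) (U : opens Y).
Implicit Types s t : div_section D U.

Lemma div_section_inj s t : (forall he, dval s he = dval t he) -> s = t.
Proof.
case: s t => [s hs] [t ht] /= e; have {}e : s = t by apply: funext.
by subst t; congr DivSection; apply: Prop_irrelevance.
Qed.

HB.instance Definition _ := gen_eqMixin (div_section D U).
HB.instance Definition _ := gen_choiceMixin (div_section D U).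

Fact div_zero_subproof y (he : U eta) : U y -> multiple_at D y 0.
Proof.
move=> Uy; have [V [f [Vy /(_ y Vy) Df]]] := cartP D y.
by apply/(multiple_atE _ Df); rewrite mulr0; apply: regular0.
Qed.
Definition div_zero := DivSection div_zero_subproof.

Fact div_add_subproof s t y (he : U eta) :
  U y -> multiple_at D y (dval s he + dval t he).
Proof.
move=> Uy; have [V [f [Vy /(_ y Vy) Df]]] := cartP D y.
apply/(multiple_atE _ Df); rewrite mulrDr.
by apply: regularD; apply/(multiple_atE _ Df); apply: dvalP.
Qed.
Definition div_add s t := DivSection (@div_add_subproof s t).

Fact div_scale_subproof (a : O U) s y (he : U eta) :
  U y -> multiple_at D y (germ O he a * dval s he).
Proof.
move=> Uy; have [V [f [Vy /(_ y Vy) Df]]] := cartP D y.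
apply/(multiple_atE _ Df); rewrite mulrCA; apply: regularM.
  exact: regular_germ.
by apply/(multiple_atE _ Df); apply: dvalP.
Qed.
Definition div_scale (a : O U) s := DivSection (@div_scale_subproof a s).

Fact div_addA : associative div_add.
Proof. by move=> s t r; apply: div_section_inj => he /=; rewrite addrA. Qed.
Fact div_addC : commutative div_add.
Proof. by move=> s t; apply: div_section_inj => he /=; rewrite addrC. Qed.
Fact div_add0 : left_id div_zero div_add.
Proof. by move=> s; apply: div_section_inj => he /=; rewrite add0r. Qed.
HB.instance Definition _ := GRing.isNmodule.Build (div_section D U)
  div_addA div_addC div_add0.

Fact div_scaleA (a b : O U) s : div_scale a (div_scale b s) = div_scale (a * b) s.
Proof. by apply: div_section_inj => he /=; rewrite germM mulrA. Qed.
Fact div_scale0 s : div_scale 0 s = 0.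
Proof. by apply: div_section_inj => he /=; rewrite germ0 mul0r. Qed.
Fact div_scale1 : left_id 1 div_scale.
Proof. by move=> s; apply: div_section_inj => he /=; rewrite germ1 mul1r. Qed.
Fact div_scaleDr : right_distributive div_scale +%R.
Proof. by move=> a s t; apply: div_section_inj => he /=; rewrite mulrDr. Qed.
Fact div_scaleDl s : {morph div_scale^~ s : a b / a + b}.
Proof. by move=> a b; apply: div_section_inj => he /=; rewrite germD mulrDl. Qed.
HB.instance Definition _ := GRing.Nmodule_isLSemiModule.Build (O U)
  (div_section D U) div_scaleA div_scale0 div_scale1 div_scaleDr div_scaleDl.
End SectionModule.

Section DivisorModule.
Variable D : cart hY.

Section Restriction.
Variables (U V : opens Y) (h : V `<=` U).

Fact div_res_subproof (s : div_section D U) y (he : V eta) :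
  V y -> multiple_at D y (dval s (h he)).
Proof. by move=> Vy; apply: dvalP; apply: h. Qed.
Definition div_res (s : div_section D U) := DivSection (@div_res_subproof s).

Fact div_res_nmod : nmod_morphism div_res.
Proof. by split=> [|s t]; apply: div_section_inj. Qed.
HB.instance Definition _ := GRing.isNmodMorphism.Build _ _ div_res div_res_nmod.
Definition div_resA : {additive div_section D U -> div_section D V} := div_res.
End Restriction.

Fact div_resZ U V (h : V `<=` U) (a : O U) (s : div_section D U) :
  div_resA h (a *: s) = res O h a *: div_resA h s.
Proof. by apply: div_section_inj => he /=; rewrite (germ_res (h _ he)). Qed.

Fact div_sheafP : is_sheaf (fun U V (h : V `<=` U) =>
  div_resA h : div_section D U -> div_section D V).
Proof.
split=> [U h s|U V W hV hW hWU s|U I V hV cov s t e|U I V hV cov s e].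
- by apply: div_section_inj => he /=; congr (dval _ _); apply: Prop_irrelevance.
- by apply: div_section_inj => he /=; congr (dval _ _); apply: Prop_irrelevance.
- apply: div_section_inj => he; have [i _ Vi] := cov _ he.
  have /(congr1 (fun s => dval s Vi)) /= := e i.
  by rewrite (Prop_irrelevance (hV i _ Vi) he).
- have ee i j (hi : V i eta) (hj : V j eta) : dval (s i) hi = dval (s j) hj.
    have h : opensI (V i) (V j) eta by split.
    have /(congr1 (fun s => dval s h)) /= := e i j _ (@opensIl _ _ _) (@opensIr _ _ _).
    by rewrite (Prop_irrelevance (opensIl h) hi) (Prop_irrelevance (opensIr h) hj).
  have cov' (he : U eta) : exists i, V i eta by have [i _ h] := cov _ he; exists i.
  pose t (he : U eta) := dval (s (sval (cid (cov' he)))) (svalP (cid (cov' he))).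
  have tP y he : U y -> multiple_at D y (t he).
    move=> /cov[i _ Vy]; have Vi := generic_mem hY Vy.
    by rewrite /t (ee _ i _ Vi); apply: dvalP.
  by exists (DivSection tP) => i; apply: div_section_inj => he /=; apply: ee.
Qed.

Definition divisor_module : omodule Y := OModule div_resZ div_sheafP.
End DivisorModule.

(** If f is an equation of D on all of U, then f s is regular on U for every
section s of O(D): it is the coordinate of s with respect to f^-1. *)
Lemma div_generator D U f (e : divisor_module D U) :
  (forall z, U z -> D z = cart_class z f) ->
  (forall he : U eta, dval e he = uinv f) -> generator e.
Proof.
move=> Df ef V h s.
have [a ea] : exists a : O V, forall he : V eta, germ O he a = uval f * dval s he.
  apply: section_of_regular => z he Vz.
  by apply/(multiple_atE _ (Df z (h z Vz))); apply: dvalP.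
exists a; split.
  by apply: div_section_inj => he /=; rewrite ea ef mulrAC uvalK mul1r.
move=> b eb; apply: germ_generic_inj => he; rewrite ea eb /= ef.
by rewrite mulrCA uvalK mulr1.
Qed.

Lemma local_equation D y : exists U f, [/\ U y,
  forall z, U z -> D z = cart_class z f &
  exists e : divisor_module D U, forall he : U eta, dval e he = uinv f].
Proof.
have [U [f [Uy Df]]] := cartP D y; exists U, f; split=> //.
have eP z (he : U eta) : U z -> multiple_at D z (uinv f).
  move=> Uz; apply/(multiple_atE _ (Df z Uz)).
  by rewrite uvalK -(germ1 O he); apply: regular_germ.
by exists (DivSection eP).
Qed.

Lemma multiple_is_value D y a : multiple_at D y a ->
  exists U (Uy : U y) (he : U eta) (s : div_section D U), dval s he = a.
Proof.
have [U [f [Uy Df [e ef]]]] := local_equation D y.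
move=> /(multiple_atE _ (Df y Uy))[V [Vy [Ve [s es]]]].
have hy : opensI U V y by split.
have he : opensI U V eta by split; first exact: generic_mem Uy.
exists (opensI U V), hy, he.
exists (res O (@opensIr _ U V) s *: mres _ (@opensIl _ U V) e : divisor_module D _).
by rewrite /= ef (germ_res Ve) -es mulrAC uvalK mul1r.
Qed.

Section Multiplication.
Variables (D E : cart hY) (c : F).
Hypothesis cDE : forall y a, multiple_at D y a -> multiple_at E y (c * a).

Fact div_mul_subproof U (s : div_section D U) y (he : U eta) :
  U y -> multiple_at E y (c * dval s he).
Proof. by move=> Uy; apply/cDE/dvalP. Qed.

Definition div_mul U (s : divisor_module D U) : divisor_module E U :=
  DivSection (@div_mul_subproof U s).

Fact div_mulZ U (a : O U) s : div_mul (a *: s) = a *: div_mul s.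
Proof. by apply: div_section_inj => he /=; rewrite mulrCA. Qed.
Fact div_mulD U (s t : divisor_module D U) :
  div_mul (s + t) = div_mul s + div_mul t.
Proof. by apply: div_section_inj => he /=; rewrite mulrDr. Qed.

Definition mul_hom : omodule_hom (opensT Y) (divisor_module D) (divisor_module E).
Proof.
apply: (@OModuleHom _ _ _ _ (fun U _ => mk_linear (@div_mulZ U) (@div_mulD U))).
by move=> V W hV hW h s; apply: div_section_inj.
Defined.
End Multiplication.

(** Near eta every section s of O(D) is a multiple of a fixed generator e, so the
image of s is s/e times the image of e. *)
Lemma hom_is_mul D E
  (g : omodule_hom (opensT Y) (divisor_module D) (divisor_module E)) :
  exists c : F, forall U (h : U `<=` opensT Y) (s : divisor_module D U) he,
    dval (hom_sec g h s : div_section E U) he = c * dval (s : div_section D U) he.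
Proof.
have [U0 [f [Ue0 Df [e ef]]]] := local_equation D eta.
have ge := div_generator Df ef.
pose e' : div_section E U0 := hom_sec g (@subopensT _ _) e.
exists (uval f * dval e' Ue0) => U h s he.
pose W := opensI U U0; have heW : W eta by split.
have [a [ea _]] := ge W (@opensIr _ U U0) (mres _ (@opensIl _ U U0) s).
have sE : dval (s : div_section D U) he = germ O heW a * uinv f.
  have /= := congr1 (fun s : div_section D W => dval s heW) ea.
  by rewrite ef (Prop_irrelevance (opensIl heW) he).
have ea' : mres _ (@opensIl _ U U0) (hom_sec g h s) =
           a *: mres (divisor_module E) (@opensIr _ U U0) e'.
  by rewrite -!(hom_res g _ (@subopensT _ W)) ea linearZ.
have := congr1 (fun s : div_section E W => dval s heW) ea'.
rewrite /= (Prop_irrelevance (opensIl heW) he) => ->.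
rewrite sE (Prop_irrelevance (opensIr heW) Ue0) [_ * uinv f]mulrC mulrACA.
by rewrite uvalK mul1r mulrC.
Qed.

Lemma multiple_shift D E (c : units F) : D = E + cart_div c ->
  forall y a, multiple_at D y a -> multiple_at E y (uval c * a).
Proof.
move=> -> y a; have [U [g [Uy /(_ y Uy) Eg]]] := cartP E y.
have Df : (E + cart_div c) y = cart_class y (g + c).
  by rewrite cart_classD -Eg.
by move=> /(multiple_atE _ Df) reg; apply/(multiple_atE _ Eg); rewrite mulrA.
Qed.

(** The hypotheses say c O(D) = O(E).  The two inclusions at y, applied to the
generators f^-1 and g^-1, show that f and c g differ by a local unit. *)
Lemma shift_of_multiple D E (c : units F) :
  (forall y a, multiple_at D y a -> multiple_at E y (uval c * a)) ->
  (forall y a, multiple_at E y a -> multiple_at D y (uinv c * a)) ->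
  D = E + cart_div c.
Proof.
move=> DE ED; apply: cart_inj => y.
have [U [f [Uy /(_ y Uy) Df]]] := cartP D y.
have [V [g [Vy /(_ y Vy) Eg]]] := cartP E y.
have own (h : units F) : regular_at y (uval h * uinv h).
  by rewrite uvalK -(germ1 O (U := opensT Y) I); apply: regular_germ.
have -> : (E + cart_div c) y = cart_class y (g + c).
  by rewrite cart_classD -Eg.
rewrite Df; apply/cart_class_eq/local_unitP; split => /=.
  have /ED/(multiple_atE _ Df) : multiple_at E y (uinv g).
    by apply/(multiple_atE _ Eg).
  by rewrite [uinv c * _]mulrC.
have /DE/(multiple_atE _ Eg) : multiple_at D y (uinv f).
  by apply/(multiple_atE _ Df).
by rewrite mulrA mulrC.
Qed.

Lemma divisor_module_isoP D E :
  isomorphic (divisor_module D) (divisor_module E) <->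
  exists c, D = E + cart_div c.
Proof.
split=> [[g /hom_inv[g' gg']]|[c DE]].
  have [c cE] := hom_is_mul g; have [c' cE'] := hom_is_mul g'.
  have cc' : c * c' = 1.
    have [U [f [Ue _ [e ef]]]] := local_equation D eta.
    have [gK _] := gg' U (@subopensT _ U).
    have := congr1 (fun s : div_section D U => dval s Ue) (gK e).
    rewrite /= cE' cE ef => e1.
    transitivity (uval f * (c' * (c * uinv f))); last by rewrite e1 uvalK.
    by rewrite [c' * (_ * _)]mulrA mulrCA uvalK mulr1 mulrC.
  have mult D1 E1 c1
      (g1 : omodule_hom (opensT Y) (divisor_module D1) (divisor_module E1)) :
      (forall U (h : U `<=` opensT Y) (s : divisor_module D1 U) he,
        dval (hom_sec g1 h s : div_section E1 U) he =
        c1 * dval (s : div_section D1 U) he) ->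
      forall y a, multiple_at D1 y a -> multiple_at E1 y (c1 * a).
    move=> g1E y a /multiple_is_value[U [Uy [he [s <-]]]].
    by rewrite -(g1E U (@subopensT _ U)); apply: dvalP.
  by exists (Units cc'); apply: shift_of_multiple; [apply: mult cE|apply: mult cE'].
have ED : E = D + cart_div (- c).
  rewrite DE -addrA -[LHS]addr0; congr (_ + _); apply: cart_inj => y.
  by rewrite /= -cart_classD addrN.
exists (mul_hom (multiple_shift DE)) => U h.
exists (hom_sec (mul_hom (multiple_shift ED)) h) => s;
  apply: div_section_inj => he /=.
  by rewrite mulrA [uinv c * _]mulrC uvalK mul1r.
by rewrite mulrA uvalK mul1r.
Qed.

Lemma divisor_module_invertible D : invertible (divisor_module D).
Proof.
move=> y; have [U [f [Uy Df [e ef]]]] := local_equation D y.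
exists U; split=> //; apply/generator_iso1; exists e.
exact: div_generator Df ef.
Qed.

End DivisorSheaf.

(** * Tensor products of the sheaves of divisors *)

Section ProductOfDivisors.
Variables (Y : scheme) (hY : is_cancellative Y).
Local Notation eta := (generic_point hY).
Local Notation O := (sheafO Y).
Implicit Types (U V W : opens Y) (D E : cart hY).

Fact div_prod_subproof D E U (s : div_section D U) (t : div_section E U) y
    (he : U eta) : U y -> multiple_at (D + E) y (dval s he * dval t he).
Proof.
move=> Uy.
have [V [f [Vy /(_ y Vy) Df]]] := cartP D y.
have [W [g [Wy /(_ y Wy) Eg]]] := cartP E y.
have DE : (D + E) y = cart_class y (f + g) by rewrite cart_classD -Df -Eg.
apply/(multiple_atE _ DE); rewrite /= mulrACA.
by apply: regularM; [apply/(multiple_atE _ Df)|apply/(multiple_atE _ Eg)];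
  apply: dvalP.
Qed.

Definition div_prod D E U (s : divisor_module D U) (t : divisor_module E U) :
  divisor_module (D + E) U := DivSection (@div_prod_subproof D E U s t).

Definition div_bilinear D E :
  obilinear (divisor_module D) (divisor_module E) (divisor_module (D + E)).
Proof.
apply: (@OBilinear _ _ _ _ (@div_prod D E)).
- by move=> U x x' y; apply: div_section_inj => he /=; rewrite mulrDl.
- by move=> U x y y'; apply: div_section_inj => he /=; rewrite mulrDr.
- by move=> U a x y; apply: div_section_inj => he /=; rewrite mulrA.
- by move=> U a x y; apply: div_section_inj => he /=; rewrite mulrCA.
- by move=> U V h x y; apply: div_section_inj.
Defined.

Lemma divisor_tensor D E L M N :
  isomorphic (divisor_module D) L -> isomorphic (divisor_module E) M ->
  isomorphic (divisor_module (D + E)) N -> is_tensor L M N.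
Proof.
move=> [i bi] [j bj] [k bk].
have [i' ii'] := hom_inv bi; have [j' jj'] := hom_inv bj.
pose t := transport_bilinear (div_bilinear D E) i' j' k.
apply: (tensor_of_generators (t := t)) => y.
have [U [f [Uy Df [e ef]]]] := local_equation D y.
have [V [g [Vy Eg [e' eg]]]] := local_equation E y.
pose W := opensI U V.
pose eD : divisor_module D W := mres _ (@opensIl _ U V) e.
pose eE : divisor_module E W := mres _ (@opensIr _ U V) e'.
have DW z : W z -> D z = cart_class z f by move=> [Uz _]; apply: Df.
have EW z : W z -> E z = cart_class z g by move=> [_ Vz]; apply: Eg.
have gD : generator eD by apply: (div_generator DW) => he; apply: ef.
have gE : generator eE by apply: (div_generator EW) => he; apply: eg.
have gDE : generator (div_bilinear D E W eD eE).
  apply: (@div_generator _ _ _ _ (f + g)) => [z Wz|he /=]; last by rewrite ef eg.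
  by rewrite cart_classD -DW -?EW.
exists W, (hom_sec i (@subopensT _ W) eD), (hom_sec j (@subopensT _ W) eE).
split=> //; do ?exact: generator_iso.
have [iK _] := ii' W (@subopensT _ W); have [jK _] := jj' W (@subopensT _ W).
by rewrite /= iK jK; apply: generator_iso.
Qed.
End ProductOfDivisors.

(** * The divisor of an invertible sheaf *)

Section DivisorOfInvertible.
Variables (Y : scheme) (hY : is_cancellative Y) (L : omodule Y).
Local Notation eta := (generic_point hY).
Local Notation F := (function_field hY).
Local Notation O := (sheafO Y).
Implicit Types (U V W : opens Y).
Variables (U0 : opens Y) (Ue0 : U0 eta) (e0 : L U0) (ge0 : generator e0).

Fact coordinate_exists U (s : L U) : exists a : O (opensI U U0),
  mres L (@opensIl _ U U0) s = a *: mres L (@opensIr _ U U0) e0.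
Proof.
have [a [ea _]] := ge0 (@opensIr _ U U0) (mres L (@opensIl _ U U0) s).
by exists a.
Qed.

(** The embedding of L into the constant sheaf F that sends e0 to 1: restrict to
where e0 generates L, and take the germ at eta of the coordinate. *)
Definition ratl U (s : L U) (he : U eta) : F :=
  germ O (conj he Ue0 : opensI U U0 eta) (sval (cid (coordinate_exists s))).

(** Any open set containing eta on which s is a multiple of e0 may be used to
compute the rational function of s. *)
Lemma ratlE U (s : L U) W (h : W `<=` U) (k : W `<=` U0) (a : O W)
    (he : U eta) (heW : W eta) :
  mres L h s = a *: mres L k e0 -> ratl s he = germ O heW a.
Proof.
rewrite /ratl; case: cid => b /= eb ea.
have hW : W `<=` opensI U U0.
  by move=> y Wy; split; [exact: (h _ Wy)|exact: (k _ Wy)].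
rewrite -(germ_res _ heW hW); congr (germ O heW _).
apply: (generator_inj (h := k) ge0); rewrite -ea.
rewrite -(mres_comp (@opensIl _ U U0) hW h) eb mresZ.
by rewrite (mres_comp _ _ k).
Qed.

Lemma ratl_res U V (h : V `<=` U) (s : L U) he he' :
  ratl (mres L h s) he = ratl s he'.
Proof.
rewrite {1}/ratl; case: cid => b /= eb; apply/esym.
apply: (ratlE (h := subset_trans (@opensIl _ V U0) h) (k := @opensIr _ V U0)).
by rewrite -eb (mres_comp _ _ (subset_trans (@opensIl _ V U0) h)).
Qed.

Lemma ratlZ U (a : O U) (s : L U) he : ratl (a *: s) he = germ O he a * ratl s he.
Proof.
rewrite {2}/ratl; case: cid => b /= eb.
rewrite -(germ_res he (conj he Ue0 : opensI U U0 eta) (@opensIl _ U U0)) -germM.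
apply: (ratlE (h := @opensIl _ U U0) (k := @opensIr _ U U0)).
by rewrite mresZ eb scalerA.
Qed.

Lemma ratlD U (s t : L U) he : ratl (s + t) he = ratl s he + ratl t he.
Proof.
rewrite {2 3}/ratl; case: cid => a /= ea; case: cid => b /= eb.
rewrite -germD; apply: (ratlE (h := @opensIl _ U U0) (k := @opensIr _ U U0)).
by rewrite raddfD /= ea eb scalerDl.
Qed.

(** A generator of L near y whose rational function is f^-1 matches the generator
f^-1 of O(D) for a divisor D of equation f at y. *)
Definition frame_at (y : Y) (f : units F) : Prop :=
  exists U (e : L U), [/\ U y, generator e & forall he, ratl e he = uinv f].

Lemma generator_frame U (e : L U) : U eta -> generator e ->
  exists f : units F, forall y, U y -> frame_at y f.
Proof.
move=> Ue ge.
have he : opensI U U0 eta by split.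
have [u eu] := generator_units (generator_res (@opensIr _ U U0) ge0)
                               (generator_res (@opensIl _ U U0) ge).
have uV : germ O he (uinv u) * germ O he (uval u) = 1.
  by rewrite -germM mulrC uvalK germ1.
exists (Units uV) => y Uy; exists U, e; split=> // he' /=.
exact: ratlE eu.
Qed.

Lemma frame_class y f f' : frame_at y f -> frame_at y f' ->
  cart_class y f = cart_class y f'.
Proof.
move=> [U [e [Uy ge ef]]] [U' [e' [Uy' ge' ef']]]; apply/cart_class_eq.
have Wy : opensI U U' y by split.
have [u eu] := generator_units (generator_res (@opensIl _ U U') ge)
                               (generator_res (@opensIr _ U U') ge').
have [Ue Ue'] : opensI U U' eta := generic_mem hY Wy.
have We : opensI U U' eta by split.
exists (opensI U U'), Wy, We, u.
have : uinv f' = germ O We (uval u) * uinv f.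
  rewrite -ef -ef' -(ratl_res (@opensIr _ U U') _ We) eu ratlZ.
  by rewrite (ratl_res _ _ _ Ue).
by move=> /= ->; rewrite mulrCA uvalK mulr1.
Qed.

Hypothesis framed : forall y, exists f, frame_at y f.

(** Near each point s and t are multiples of a generator, whose rational function
is a unit; so their coordinates have the same germ at eta, hence are equal. *)
Lemma ratl_inj U (s t : L U) : (forall he, ratl s he = ratl t he) -> s = t.
Proof.
move=> est; apply: (sheaf_separated (msheafP L)) => y Uy.
have [f [V [e [Vy ge ef]]]] := framed y.
exists (opensI U V), (@opensIl _ U V); split=> //.
have [a [ea _]] := ge _ (@opensIr _ U V) (mres L (@opensIl _ U V) s).
have [b [eb _]] := ge _ (@opensIr _ U V) (mres L (@opensIl _ U V) t).
rewrite ea eb; congr (_ *: _); apply: germ_generic_inj => We.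
have [Ue Ve] := We; have := est Ue.
rewrite -!(ratl_res (@opensIl _ U V) _ We) ea eb !ratlZ (ratl_res _ _ _ Ve) ef.
by move=> /(congr1 ( *%R (uval f))); rewrite !(mulrCA (uval f)) uvalK !mulr1.
Qed.

(** The inverses of the rational functions of local generators are the equations
of D.  The map s |-> ratl s then lands in O(D), is injective, and a section d of
O(D) is locally the image of f d times the generator at hand; these preimages
glue by injectivity. *)
Lemma divisor_of_invertible : exists D : cart hY, isomorphic L (divisor_module D).
Proof.
have [f fP] := choice framed.
have locD : cart_local (fun y => cart_class y (f y)).
  move=> y; have [U [e [Uy ge ef]]] := fP y; exists U, (f y); split=> // z Uz.
  by apply: frame_class (fP z) _; exists U, e.
pose D := Cartier locD; exists D.
have DE y : D y = cart_class y (f y) by [].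
have gP U (s : L U) y (he : U eta) : U y -> multiple_at D y (ratl s he).
  move=> Uy; apply/(multiple_atE _ (DE y)).
  have [V [e [Vy ge ef]]] := fP y.
  have [a [ea _]] := ge _ (@opensIr _ U V) (mres L (@opensIl _ U V) s).
  have We : opensI U V eta by split; last exact: generic_mem Vy.
  rewrite -(ratl_res (@opensIl _ U V) _ We) ea ratlZ (ratl_res _ _ _ We.2) ef.
  by rewrite mulrCA uvalK mulr1; apply: regular_germ.
pose g U (s : L U) : divisor_module D U := DivSection (@gP U s).
have gZ U (a : O U) s : g U (a *: s) = a *: g U s.
  by apply: div_section_inj => he /=; rewrite ratlZ.
have gD U s t : g U (s + t) = g U s + g U t.
  by apply: div_section_inj => he /=; rewrite ratlD.
have gr V W (hV : V `<=` opensT Y) (hW : W `<=` opensT Y) (h : W `<=` V) s :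
    mk_linear (gZ W) (gD W) (mres L h s) = mres _ h (mk_linear (gZ V) (gD V) s).
  by apply: div_section_inj => he /=; apply: ratl_res.
exists (OModuleHom gr) => U h /=; apply: bij_of_inj_surj => [s t /= est|d].
  apply: ratl_inj => he.
  exact: (congr1 (fun s : div_section D U => dval s he) est).
pose P V (t : L V) := forall (he : V eta) (he' : U eta),
  ratl t he = dval (d : div_section D U) he'.
have loc y : U y -> exists V : opens Y, [/\ V `<=` U, V y & exists t, P V t].
  move=> Uy; have [V [e [Vy ge ef]]] := fP y.
  have Ue := generic_mem hY Uy.
  have /(multiple_atE _ (DE y))[T [Ty [Te [a ea]]]] := dvalP d Ue Uy.
  pose W := opensI (opensI U V) T.
  have WU : W `<=` U by move=> z [[]].
  have WV : W `<=` V by move=> z [[]].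
  exists W; split=> //; exists (res O (@opensIr _ _ T) a *: mres L WV e) => he he'.
  rewrite ratlZ (germ_res Te) -ea (ratl_res _ _ _ (WV _ he)) ef mulrAC uvalK mul1r.
  by rewrite (Prop_irrelevance Ue he').
have [||t tP] := sheaf_glue (msheafP L) _ _ loc.
- by move=> V W k t _ Pt he he'; rewrite (ratl_res _ _ _ (k _ he)); apply: Pt.
- move=> V t t' VU Pt Pt'; apply: ratl_inj => he.
  by rewrite (Pt _ (VU _ he)) (Pt' _ (VU _ he)).
exists t; apply: div_section_inj => he /=.
have [V [VU Ve [t' Pt']]] := loc _ he.
by rewrite -(ratl_res VU _ Ve) (tP _ _ _ Pt') (Pt' Ve he).
Qed.
End DivisorOfInvertible.

Lemma invertible_divisor (Y : scheme) (hY : is_cancellative Y) (L : omodule Y) :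
  invertible L -> exists D : cart hY, isomorphic (divisor_module D) L.
Proof.
move=> invL.
have gen y : exists U (e : L U), U y /\ generator e.
  by have [U [Uy /generator_iso1[e ge]]] := invL y; exists U, e.
have [U0 [e0 [Ue0 ge0]]] := gen (generic_point hY).
have [|D LD] := @divisor_of_invertible _ hY _ _ Ue0 _ ge0.
  move=> y; have [U [e [Uy ge]]] := gen y.
  have [f fP] := generator_frame Ue0 ge0 (generic_mem hY Uy) ge.
  by exists f; apply: fP.
by exists D; apply: isomorphic_sym.
Qed.

(** * The class group and the Picard group *)

Lemma Pic_inj (Y : srspace) (a b : Pic Y) : pic_class a = pic_class b -> a = b.
Proof.
case: a b => [a pa] [b pb] /= e; subst b; congr PicClass; exact: Prop_irrelevance.
Qed.

Lemma isomorphic_class (Y : srspace) (L M : omodule Y) :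
  isomorphic L M -> isomorphic L = isomorphic M.
Proof.
move=> LM; apply/funext => N; apply/propext; split; last exact: isomorphic_trans.
by apply: isomorphic_trans; apply: isomorphic_sym.
Qed.

Lemma CaCl_eq (Y : scheme) (hY : is_cancellative Y) (D E : cart hY) :
  \pi_(CaCl hY) D = \pi_(CaCl hY) E <-> exists c, D = E + cart_div c.
Proof.
have -> : (exists c, D = E + cart_div c) <-> D - E \in @principal Y hY.
  split=> [[c ->]|/asboolP[c ec]]; last by exists c; rewrite -ec addrC subrK.
  by apply/asboolP; exists c; rewrite addrC addKr.
by rewrite Quotient.idealrBE; split=> [->|/eqP].
Qed.

(** The class of O(D) for an arbitrary representative D; by [divisor_module_isoP]
it does not depend on the representative. *)
Definition line_bundle_class (Y : scheme) (hY : is_cancellative Y)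
    (D : CaCl hY) : Pic Y :=
  PicClass (ex_intro _ (divisor_module (repr D))
    (conj (divisor_module_invertible _) erefl)).

Lemma line_bundle_classE (Y : scheme) (hY : is_cancellative Y) (D : cart hY) :
  pic_class (line_bundle_class (\pi_(CaCl hY) D)) = isomorphic (divisor_module D).
Proof.
by apply/isomorphic_class/divisor_module_isoP/CaCl_eq; rewrite reprK.
Qed.

Local Close Scope classical_set_scope.

Theorem theoremB (K : comNzSemiRingType) (hK : is_semifield K)
  (hKid : is_idempotent K) (X : scheme) (hX : is_cancellative X)
  (f : srmorph X (Spec K)) (hf : is_local_mor f) :
  exists phi : CaCl hX -> Pic X,
    bijective phi /\
    (forall D E : CaCl hX, is_pic_mul (phi D) (phi E) (phi (D + E))).
Proof.
exists (@line_bundle_class X hX); split.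
  apply: bij_of_inj_surj => [D E|a].
    rewrite -[D]reprK -[E]reprK => /(congr1 (@pic_class X)).
    rewrite !line_bundle_classE => DE.
    by apply/CaCl_eq/divisor_module_isoP; rewrite DE; apply: isomorphic_refl.
  have [L [invL La]] := picP a; have [D DL] := invertible_divisor hX invL.
  exists (\pi D); apply: Pic_inj; rewrite line_bundle_classE La.
  exact: isomorphic_class.
move=> D E L M N; rewrite -[D]reprK -[E]reprK -(raddfD (\pi_(CaCl hX))).
rewrite !line_bundle_classE => DL EM; split=> [DEN|LMN].
  exact: divisor_tensor DL EM DEN.
apply: tensor_unique LMN.
exact: divisor_tensor DL EM (isomorphic_refl _).
Qed.
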